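(* Let $\lambda$ be an infinite regular cardinal and let $\mathcal{A}$ be a Grothendieck category. Then the $\lambda$-pure singularity category $$\mathbf{D}_{\lambda\text{-}sg}^{b}(\mathcal{A}):=\mathbf{D}_{\lambda}^{b}(\mathcal{A})/\mathbf{K}^{b}(\mathcal{PP}_\lambda)$$ is zero if and only if the $\lambda$-pure global dimension of $\mathcal{A}$ is finite.
   Context: Complexes are cochain complexes; $\mathbf{K}^b(\mathcal{A})$ is the homotopy category of bounded complexes over $\mathcal{A}$. An object $F$ of $\mathcal{A}$ is $\lambda$-presentable if $\mathrm{Hom}_{\mathcal{A}}(F,-)$ commutes with $\lambda$-directed colimits. A short exact sequence $\xi$ in $\mathcal{A}$ is $\lambda$-pure if $\mathrm{Hom}_{\mathcal{A}}(F,\xi)$ is exact for every $\lambda$-presentable $F$. An object is $\lambda$-pure projective if it is projective with respect to all $\lambda$-pure short exact sequences; $\mathcal{PP}_\lambda$ is the class of all such objects. A complex $X$ is $\lambda$-pure acyclic if $\mathrm{Hom}_{\mathcal{A}}(P,X)$ is acyclic for every $\lambda$-presentable (more generally, $\lambda$-pure projective) object $P$. A cochain map is a $\lambda$-pure quasi-isomorphism if its mapping cone is $\lambda$-pure acyclic. $\mathbf{D}_{\lambda}^{b}(\mathcal{A})=\mathbf{K}^{b}(\mathcal{A})/\mathbf{K}_{\lambda}^{b}(\mathcal{A})$ is the Verdier quotient by the full subcategory of bounded $\lambda$-pure acyclic complexes. $\mathbf{K}^{b}(\mathcal{PP}_\lambda)$ is the full subcategory of $\mathbf{K}^b(\mathcal{A})$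 of bounded complexes with terms in $\mathcal{PP}_\lambda$, identified with its image in $\mathbf{D}_\lambda^b(\mathcal{A})$; the quotient defining $\mathbf{D}_{\lambda\text{-}sg}^{b}(\mathcal{A})$ is a Verdier quotient. A $\lambda$-pure projective resolution of a complex $X$ is a $\lambda$-pure quasi-isomorphism $P\to X$ with $P$ a complex of $\lambda$-pure projective objects. The $\lambda$-pure projective dimension of $X$ is at most $n$ if there is such a resolution with $P^i=0$ for all $i<-n$ (and it is $\infty$ if there is no such $n$); objects of $\mathcal{A}$ are viewed as stalk complexes in degree $0$. The $\lambda$-pure global dimension of $\mathcal{A}$ is the supremum of the $\lambda$-pure projective dimensions of all objects of $\mathcal{A}$; ''finite'' means $<\infty$. *)

(* Defs.v *)
From mathcomp Require Import all_boot all_order all_algebra.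
From mathcomp Require Import boolp classical_sets functions cardinality.

Set Implicit Arguments.
Unset Strict Implicit.
Unset Printing Implicit Defensive.

Import Order.TTheory GRing.Theory Num.Theory.
Local Open Scope classical_set_scope.
Local Open Scope ring_scope.

(* A cardinal is represented by a type L of that cardinality. *)

Definition card_lt (T U : Type) (A : set T) (B : set U) : Prop :=
  (A #<= B)%card /\ ~ (B #<= A)%card.

(* L is not the union of fewer than |L| subsets of cardinality less than |L|. *)
Definition infinite_regular (L : Type) : Prop :=
  infinite_set [set: L] /\
  forall (I : Type) (F : I -> set L),
    card_lt [set: I] [set: L] -> (forall i, card_lt (F i) [set: L]) ->
    \bigcup_i F i <> [set: L].

(* |L|-directed posets; L = nat gives the usual directed posets. *)
Definition directed (L : Type) (disp : Order.disp_t) (I : porderType disp) :=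
  forall S : set I, card_lt S [set: L] -> exists u, forall i, S i -> (i <= u)%O.

(* Additive categories, with a chosen zero object and chosen biproducts. *)

Record additive_category := AdditiveCategory {
  aobj :> Type;
  ahom : aobj -> aobj -> zmodType;
  aid : forall X, ahom X X;
  acomp : forall X Y Z, ahom Y Z -> ahom X Y -> ahom X Z;
  acompA : forall W X Y Z (h : ahom Y Z) (g : ahom X Y) (f : ahom W X),
    acomp h (acomp g f) = acomp (acomp h g) f;
  acomp1f : forall X Y (f : ahom X Y), acomp (aid Y) f = f;
  acompf1 : forall X Y (f : ahom X Y), acomp f (aid X) = f;
  acompDl : forall X Y Z (g g' : ahom Y Z) (f : ahom X Y),
    acomp (g + g') f = acomp g f + acomp g' f;
  acompDr : forall X Y Z (g : ahom Y Z) (f f' : ahom X Y),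
    acomp g (f + f') = acomp g f + acomp g f';
  azero : aobj;
  azero_id : aid azero = 0;
  abip : aobj -> aobj -> aobj;
  ain1 : forall X Y, ahom X (abip X Y);
  ain2 : forall X Y, ahom Y (abip X Y);
  apr1 : forall X Y, ahom (abip X Y) X;
  apr2 : forall X Y, ahom (abip X Y) Y;
  apr1_in1 : forall X Y, acomp (apr1 X Y) (ain1 X Y) = aid X;
  apr2_in2 : forall X Y, acomp (apr2 X Y) (ain2 X Y) = aid Y;
  apr1_in2 : forall X Y, acomp (apr1 X Y) (ain2 X Y) = 0;
  apr2_in1 : forall X Y, acomp (apr2 X Y) (ain1 X Y) = 0;
  abip_id : forall X Y, acomp (ain1 X Y) (apr1 X Y)
                      + acomp (ain2 X Y) (apr2 X Y) = aid (abip X Y)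
}.

Arguments aid {_} _.
Arguments acomp {_ _ _ _} _ _.
Arguments ain1 {_} _ _.
Arguments ain2 {_} _ _.
Arguments apr1 {_} _ _.
Arguments apr2 {_} _ _.
Notation "g \oa f" := (acomp g f) (at level 40, left associativity).

Section Additive.
Variable A : additive_category.
Implicit Types X Y Z W : A.

Lemma acomp0l X Y Z (f : ahom X Y) : (0 : ahom Y Z) \oa f = 0.
Proof. by apply: (addIr ((0 : ahom Y Z) \oa f)); rewrite -acompDl !add0r. Qed.

Lemma acomp0r X Y Z (g : ahom Y Z) : g \oa (0 : ahom X Y) = 0.
Proof. by apply: (addIr (g \oa (0 : ahom X Y))); rewrite -acompDr !add0r. Qed.

Lemma acompNl X Y Z (g : ahom Y Z) (f : ahom X Y) : (- g) \oa f = - (g \oa f).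
Proof. by apply: (addIr (g \oa f)); rewrite -acompDl !addNr acomp0l. Qed.

Lemma acompNr X Y Z (g : ahom Y Z) (f : ahom X Y) : g \oa (- f) = - (g \oa f).
Proof. by apply: (addIr (g \oa f)); rewrite -acompDr !addNr acomp0r. Qed.

Definition is_zero X : Prop := aid X = 0.

Definition mono X Y (f : ahom X Y) : Prop :=
  forall W (u v : ahom W X), f \oa u = f \oa v -> u = v.

Definition epi X Y (f : ahom X Y) : Prop :=
  forall W (u v : ahom Y W), u \oa f = v \oa f -> u = v.

Definition is_kernel X Y Z (k : ahom X Y) (g : ahom Y Z) : Prop :=
  g \oa k = 0 /\
  forall W (u : ahom W Y), g \oa u = 0 -> exists! v : ahom W X, k \oa v = u.

Definition is_cokernel X Y Z (c : ahom Y Z) (f : ahom X Y) : Prop :=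
  c \oa f = 0 /\
  forall W (u : ahom Y W), u \oa f = 0 -> exists! v : ahom Z W, v \oa c = u.

Definition short_exact X Y Z (f : ahom X Y) (g : ahom Y Z) : Prop :=
  is_kernel f g /\ is_cokernel g f.

Definition abelian : Prop :=
  [/\ forall Y Z (g : ahom Y Z), exists X (k : ahom X Y), is_kernel k g,
      forall X Y (f : ahom X Y), exists Z (c : ahom Y Z), is_cokernel c f,
      forall X Y (f : ahom X Y), mono f ->
        exists Z (g : ahom Y Z), is_kernel f g
    & forall Y Z (g : ahom Y Z), epi g ->
        exists X (f : ahom X Y), is_cokernel g f].

Definition has_coproducts : Prop :=
  forall (I : Type) (X : I -> A), exists (C : A) (c : forall i, ahom (X i) C),
    forall W (w : forall i, ahom (X i) W),
      exists! u : ahom C W, forall i, u \oa c i = w i.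

Definition is_generator (G : A) : Prop :=
  forall X Y (f g : ahom X Y), f <> g -> exists h : ahom G X, f \oa h <> g \oa h.

Record diagram (disp : Order.disp_t) (I : porderType disp) := Diagram {
  dobj :> I -> A;
  dmor : forall i j, (i <= j)%O -> ahom (dobj i) (dobj j);
  dmor_id : forall i (le_ii : (i <= i)%O), dmor le_ii = aid (dobj i);
  dmor_comp : forall i j k (le_ij : (i <= j)%O) (le_jk : (j <= k)%O)
    (le_ik : (i <= k)%O), dmor le_jk \oa dmor le_ij = dmor le_ik
}.

Section Colimits.
Variables (disp : Order.disp_t) (I : porderType disp).

Definition is_cocone (D : diagram I) C (c : forall i, ahom (D i) C) : Prop :=
  forall i j (le_ij : (i <= j)%O), c j \oa dmor D le_ij = c i.

Definition is_colimit (D : diagram I) C (c : forall i, ahom (D i) C) : Prop :=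
  is_cocone c /\
  forall W (w : forall i, ahom (D i) W), is_cocone w ->
    exists! u : ahom C W, forall i, u \oa c i = w i.

(* The functions Hom(F, D i) -> Hom(F, C) form a colimit cocone of sets. *)
Definition hom_colimit (F : A) (D : diagram I) C
    (c : forall i, ahom (D i) C) : Prop :=
  forall (T : Type) (t : forall i, ahom F (D i) -> T),
    (forall i j (le_ij : (i <= j)%O) u, t j (dmor D le_ij \oa u) = t i u) ->
    exists! h : ahom F C -> T, forall i u, h (c i \oa u) = t i u.

Definition natural (D E : diagram I) (f : forall i, ahom (D i) (E i)) : Prop :=
  forall i j (le_ij : (i <= j)%O), f j \oa dmor D le_ij = dmor E le_ij \oa f i.

End Colimits.

Definition exact_directed_colimits : Prop :=
  forall (disp : Order.disp_t) (I : porderType disp) (D D' D'' : diagram I)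
    (f : forall i, ahom (D i) (D' i)) (g : forall i, ahom (D' i) (D'' i))
    C C' C'' (c : forall i, ahom (D i) C) (c' : forall i, ahom (D' i) C')
    (c'' : forall i, ahom (D'' i) C'') (fC : ahom C C') (gC : ahom C' C''),
  directed nat I -> natural f -> natural g ->
  is_colimit c -> is_colimit c' -> is_colimit c'' ->
  (forall i, fC \oa c i = c' i \oa f i) ->
  (forall i, gC \oa c' i = c'' i \oa g i) ->
  (forall i, short_exact (f i) (g i)) -> short_exact fC gC.

Definition grothendieck : Prop :=
  [/\ abelian, has_coproducts, exact_directed_colimits
    & exists G : A, is_generator G].

End Additive.

Section Purity.
Variables (L : Type) (A : additive_category).

Definition presentable (F : A) : Prop :=
  forall (disp : Order.disp_t) (I : porderType disp) (D : diagram A I) (C : A)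
    (c : forall i, ahom (D i) C),
  directed L I -> is_colimit c -> hom_colimit F c.

Definition exact_at (U V W : zmodType) (f : U -> V) (g : V -> W) : Prop :=
  forall v, g v = 0 <-> exists u, f u = v.

Definition pure_exact (X Y Z : A) (f : ahom X Y) (g : ahom Y Z) : Prop :=
  short_exact f g /\
  forall F : A, presentable F ->
    [/\ injective (fun u : ahom F X => f \oa u),
        exact_at (fun u : ahom F X => f \oa u) (fun v : ahom F Y => g \oa v)
      & forall w : ahom F Z, exists v, g \oa v = w].

Definition pure_projective (P : A) : Prop :=
  forall (X Y Z : A) (f : ahom X Y) (g : ahom Y Z), pure_exact f g ->
  forall h : ahom P Z, exists h' : ahom P Y, g \oa h' = h.

Lemma presentable_pure_projective (F : A) : presentable F -> pure_projective F.
Proof. by move=> pF X Y Z f g [_ /(_ F pF)[_ _ surj_g]] h; apply: surj_g. Qed.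

End Purity.

(* Cochain complexes.  All degrees are of the form n, n + 1, n + 1 + 1, so that
   shifts and cones require no transport along equalities of degrees. *)

Record cochain_complex (A : additive_category) := CochainComplex {
  cobj :> int -> A;
  cdiff : forall n, ahom (cobj n) (cobj (n + 1));
  cdiff2 : forall n, cdiff (n + 1) \oa cdiff n = 0
}.

Section Complexes.
Variable A : additive_category.
Implicit Types X Y Z : cochain_complex A.

Record chain_map X Y := ChainMap {
  cmap :> forall n, ahom (X n) (Y n);
  cmap_diff : forall n, cmap (n + 1) \oa cdiff X n = cdiff Y n \oa cmap n
}.

Lemma chain_id_subproof X n :
  aid (X (n + 1)) \oa cdiff X n = cdiff X n \oa aid (X n).
Proof. by rewrite acomp1f acompf1. Qed.
Definition chain_id X : chain_map X X := ChainMap (chain_id_subproof X).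

Lemma chain_comp_subproof X Y Z (g : chain_map Y Z) (f : chain_map X Y) n :
  g (n + 1) \oa f (n + 1) \oa cdiff X n = cdiff Z n \oa (g n \oa f n).
Proof. by rewrite -acompA cmap_diff !acompA cmap_diff. Qed.
Definition chain_comp X Y Z (g : chain_map Y Z) (f : chain_map X Y) :
  chain_map X Z := ChainMap (chain_comp_subproof g f).

(* s n : X^(n+1) -> Y^n, and f - g = d s + s d in every degree n + 1. *)
Definition homotopic X Y (f g : chain_map X Y) : Prop :=
  exists s : forall n, ahom (X (n + 1)) (Y n), forall n,
    f (n + 1) - g (n + 1) = cdiff Y n \oa s n + s (n + 1) \oa cdiff X (n + 1).

Lemma homotopic_refl X Y (f : chain_map X Y) : homotopic f f.
Proof.
by exists (fun n => 0) => n; rewrite subrr acomp0l acomp0r addr0.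
Qed.

Lemma homotopic_sym X Y (f g : chain_map X Y) : homotopic f g -> homotopic g f.
Proof.
move=> [s sP]; exists (fun n => - s n) => n.
by rewrite -opprB sP acompNl acompNr opprD.
Qed.

Lemma homotopic_trans X Y (f g h : chain_map X Y) :
  homotopic f g -> homotopic g h -> homotopic f h.
Proof.
move=> [s sP] [t tP]; exists (fun n => s n + t n) => n.
by rewrite -(subrKA (g (n + 1))) sP tP acompDl acompDr addrACA.
Qed.

Lemma homotopic_comp X Y Z (g g' : chain_map Y Z) (f f' : chain_map X Y) :
  homotopic g g' -> homotopic f f' ->
  homotopic (chain_comp g f) (chain_comp g' f').
Proof.
move=> [s sP] [t tP].
exists (fun n => s n \oa f (n + 1) + g' n \oa t n) => n /=.
rewrite -(subrKA (g' (n + 1) \oa f (n + 1))).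
rewrite -acompNl -acompDl -acompNr -acompDr sP tP.
rewrite !acompDl !acompDr !acompA -cmap_diff -!acompA -cmap_diff.
by rewrite addrACA.
Qed.

Definition shiftc_diff X n : ahom (X (n + 1)) (X (n + 1 + 1)) :=
  - cdiff X (n + 1).
Lemma shiftc_subproof X n : shiftc_diff X (n + 1) \oa shiftc_diff X n = 0.
Proof. by rewrite acompNl acompNr cdiff2 !oppr0. Qed.
Definition shiftc X : cochain_complex A :=
  @CochainComplex A (fun n => X (n + 1)) (shiftc_diff X) (shiftc_subproof X).

Lemma shiftc_map_subproof X Y (f : chain_map X Y) n :
  f (n + 1 + 1) \oa cdiff (shiftc X) n = cdiff (shiftc Y) n \oa f (n + 1).
Proof. by rewrite /= acompNl acompNr cmap_diff. Qed.
Definition shiftc_map X Y (f : chain_map X Y) :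
  chain_map (shiftc X) (shiftc Y) :=
  @ChainMap (shiftc X) (shiftc Y) (fun n => f (n + 1)) (shiftc_map_subproof f).

(* The mapping cone X^(n+1) (+) Y^n, with d (x, y) = (- d x, f x + d y). *)
Definition cone_diff X Y (f : chain_map X Y) n :
    ahom (abip (X (n + 1)) (Y n)) (abip (X (n + 1 + 1)) (Y (n + 1))) :=
  ain1 _ _ \oa (- cdiff X (n + 1)) \oa apr1 _ _
  + ain2 _ _ \oa (f (n + 1) \oa apr1 _ _ + cdiff Y n \oa apr2 _ _).

Lemma apr1_cone_diff X Y (f : chain_map X Y) n :
  apr1 _ _ \oa cone_diff f n = - cdiff X (n + 1) \oa apr1 _ _.
Proof.
by rewrite acompDr !acompA apr1_in1 apr1_in2 acomp0l addr0 acomp1f.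
Qed.

Lemma apr2_cone_diff X Y (f : chain_map X Y) n :
  apr2 _ _ \oa cone_diff f n
  = f (n + 1) \oa apr1 _ _ + cdiff Y n \oa apr2 _ _.
Proof.
by rewrite acompDr !acompA apr2_in1 apr2_in2 !acomp0l add0r acomp1f.
Qed.

Lemma cone_subproof X Y (f : chain_map X Y) n :
  cone_diff f (n + 1) \oa cone_diff f n = 0.
Proof.
rewrite {1}/cone_diff acompDl -!acompA acompDl -!acompA.
rewrite apr1_cone_diff apr2_cone_diff.
have -> : - cdiff X (n + 1 + 1) \oa (- cdiff X (n + 1) \oa apr1 _ (Y n)) = 0.
  by rewrite acompA acompNl acompNr opprK cdiff2 acomp0l.
have -> : f (n + 1 + 1) \oa (- cdiff X (n + 1) \oa apr1 _ (Y n))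
    + cdiff Y (n + 1) \oa (f (n + 1) \oa apr1 _ _ + cdiff Y n \oa apr2 _ _) = 0.
  rewrite acompDr !acompA acompNr cmap_diff cdiff2.
  by rewrite acomp0l addr0 -acompDl addNr acomp0l.
by rewrite !acomp0r addr0.
Qed.

Definition cone X Y (f : chain_map X Y) : cochain_complex A :=
  @CochainComplex A (fun n => abip (X (n + 1)) (Y n)) (cone_diff f)
    (cone_subproof f).

Lemma cone_in_subproof X Y (f : chain_map X Y) n :
  ain2 (X (n + 1 + 1)) (Y (n + 1)) \oa cdiff Y n
  = cdiff (cone f) n \oa ain2 (X (n + 1)) (Y n).
Proof.
by rewrite /= /cone_diff !acompDl -!acompA acompDl -!acompA apr1_in2 apr2_in2
  !acomp0r !add0r acompf1.
Qed.
Definition cone_in X Y (f : chain_map X Y) : chain_map Y (cone f) :=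
  @ChainMap Y (cone f) (fun n => ain2 (X (n + 1)) (Y n)) (cone_in_subproof f).

Lemma cone_out_subproof X Y (f : chain_map X Y) n :
  apr1 (X (n + 1 + 1)) (Y (n + 1)) \oa cdiff (cone f) n
  = cdiff (shiftc X) n \oa apr1 (X (n + 1)) (Y n).
Proof.
exact: apr1_cone_diff.
Qed.
Definition cone_out X Y (f : chain_map X Y) : chain_map (cone f) (shiftc X) :=
  @ChainMap (cone f) (shiftc X) (fun n => apr1 (X (n + 1)) (Y n))
    (cone_out_subproof f).

Lemma stalk_subproof (M : A) (n : int) :
  (0 : ahom (if n + 1 == 0 then M else azero A)
            (if n + 1 + 1 == 0 then M else azero A))
  \oa (0 : ahom (if n == 0 then M else azero A) _) = 0.
Proof. exact: acomp0l. Qed.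
Definition stalk (M : A) : cochain_complex A :=
  @CochainComplex A (fun n => if n == 0 then M else azero A) (fun n => 0)
    (stalk_subproof M).

Definition bounded X : Prop :=
  exists a b : int, forall n : int, (n < a) || (b < n) -> is_zero (X n).

Lemma bounded_shift X : bounded X -> bounded (shiftc X).
Proof.
move=> [a [b Xab]]; exists (a - 1), (b - 1) => n nab; apply: Xab.
by rewrite ltrBrDr ltrBlDr in nab.
Qed.

Lemma is_zero_abip (U V : A) : is_zero U -> is_zero V -> is_zero (abip U V).
Proof.
move=> U0 V0; rewrite /is_zero -abip_id.
rewrite -[apr1 U V]acomp1f -[apr2 U V]acomp1f U0 V0.
by rewrite !acomp0l !acomp0r addr0.
Qed.

Lemma bounded_cone X Y (f : chain_map X Y) :
  bounded X -> bounded Y -> bounded (cone f).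
Proof.
move=> /bounded_shift [a [b Xab]] [a' [b' Yab]].
exists (Num.min a a'), (Num.max b b') => n; rewrite lt_min gt_max => nab.
by case/orP: nab => /andP[nX nY]; apply: is_zero_abip;
  [apply: Xab | apply: Yab | apply: Xab | apply: Yab]; rewrite ?nX ?nY ?orbT.
Qed.

End Complexes.

(* Categories whose morphisms are taken up to an equivalence relation; two
   morphisms related by heq count as equal. *)

Record category := Category {
  obj :> Type;
  hom : obj -> obj -> Type;
  heq : forall X Y, hom X Y -> hom X Y -> Prop;
  idc : forall X, hom X X;
  compc : forall X Y Z, hom Y Z -> hom X Y -> hom X Z;
  heq_refl : forall X Y (f : hom X Y), heq f f;
  heq_sym : forall X Y (f g : hom X Y), heq f g -> heq g f;
  heq_trans : forall X Y (f g h : hom X Y), heq f g -> heq g h -> heq f h;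
  heq_comp : forall X Y Z (g g' : hom Y Z) (f f' : hom X Y),
    heq g g' -> heq f f' -> heq (compc g f) (compc g' f');
  compcA : forall W X Y Z (h : hom Y Z) (g : hom X Y) (f : hom W X),
    heq (compc h (compc g f)) (compc (compc h g) f);
  compc1f : forall X Y (f : hom X Y), heq (compc (idc Y) f) f;
  compcf1 : forall X Y (f : hom X Y), heq (compc f (idc X)) f
}.

Arguments idc {_} _.
Arguments compc {_ _ _ _} _ _.
Arguments heq {_ _ _} _ _.
Notation "g \oc f" := (compc g f) (at level 40, left associativity).
Notation "f ~= g" := (heq f g) (at level 70, no associativity).

Record functor (C D : category) := Functor {
  fobj :> C -> D;
  fmap : forall X Y, hom X Y -> hom (fobj X) (fobj Y);
  fmap_heq : forall X Y (f g : hom X Y),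
    f ~= g -> fmap f ~= fmap g;
  fmap_id : forall X, fmap (idc X) ~= idc (fobj X);
  fmap_comp : forall X Y Z (g : hom Y Z) (f : hom X Y),
    fmap (g \oc f) ~= fmap g \oc fmap f
}.

Definition is_iso (C : category) (X Y : C) (f : hom X Y) : Prop :=
  exists g : hom Y X, g \oc f ~= idc X /\ f \oc g ~= idc Y.

Lemma is_iso_comp (C : category) (X Y Z : C) (g : hom Y Z) (f : hom X Y) :
  is_iso g -> is_iso f -> is_iso (g \oc f).
Proof.
have cancel (U V W : C) (p' : hom V U) (p : hom U V) (q' : hom U W)
    (q : hom W U) : p' \oc p ~= idc U -> q' \oc q ~= idc W ->
    (q' \oc p') \oc (p \oc q) ~= idc W.
  move=> p'p q'q; apply: heq_trans (heq_sym (compcA _ _ _)) _.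
  apply: heq_trans q'q; apply: heq_comp (heq_refl _) _.
  apply: heq_trans (compcA _ _ _) _.
  by apply: heq_trans (heq_comp p'p (heq_refl _)) _; apply: compc1f.
move=> [g' [g'g gg']] [f' [f'f ff']].
by exists (f' \oc g'); split; apply: cancel.
Qed.

Definition is_zero_object (C : category) (Z : C) : Prop := forall X : C,
  (exists u : hom Z X, forall v : hom Z X, v ~= u) /\
  (exists u : hom X Z, forall v : hom X Z, v ~= u).

Definition zero_category (C : category) : Prop :=
  forall Z : C, is_zero_object Z.

(* The Gabriel-Zisman localization: formal composites of morphisms of C and of
   inverses of morphisms in W, modulo the least congruence making the canonical
   map functorial and the formal inverses inverse. *)

Section Localization.
Variables (C : category) (W : forall X Y : C, hom X Y -> Prop).

Inductive loc_hom : C -> C -> Type :=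
| loc_mor X Y : hom X Y -> loc_hom X Y
| loc_inv X Y (w : hom X Y) : W w -> loc_hom Y X
| loc_comp X Y Z : loc_hom Y Z -> loc_hom X Y -> loc_hom X Z.

Inductive loc_heq : forall X Y, loc_hom X Y -> loc_hom X Y -> Prop :=
| loc_refl X Y (f : loc_hom X Y) : loc_heq f f
| loc_sym X Y (f g : loc_hom X Y) : loc_heq f g -> loc_heq g f
| loc_trans X Y (f g h : loc_hom X Y) :
    loc_heq f g -> loc_heq g h -> loc_heq f h
| loc_congr X Y Z (g g' : loc_hom Y Z) (f f' : loc_hom X Y) :
    loc_heq g g' -> loc_heq f f' -> loc_heq (loc_comp g f) (loc_comp g' f')
| loc_assoc U X Y Z (h : loc_hom Y Z) (g : loc_hom X Y) (f : loc_hom U X) :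
    loc_heq (loc_comp h (loc_comp g f)) (loc_comp (loc_comp h g) f)
| loc_id_l X Y (f : loc_hom X Y) : loc_heq (loc_comp (loc_mor (idc Y)) f) f
| loc_id_r X Y (f : loc_hom X Y) : loc_heq (loc_comp f (loc_mor (idc X))) f
| loc_mor_heq X Y (f g : hom X Y) :
    f ~= g -> loc_heq (loc_mor f) (loc_mor g)
| loc_mor_comp X Y Z (g : hom Y Z) (f : hom X Y) :
    loc_heq (loc_mor (g \oc f)) (loc_comp (loc_mor g) (loc_mor f))
| loc_inv_l X Y (w : hom X Y) (Ww : W w) :
    loc_heq (loc_comp (loc_inv Ww) (loc_mor w)) (loc_mor (idc X))
| loc_inv_r X Y (w : hom X Y) (Ww : W w) :
    loc_heq (loc_comp (loc_mor w) (loc_inv Ww)) (loc_mor (idc Y)).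

Definition localization : category :=
  @Category C loc_hom loc_heq (fun X => loc_mor (idc X)) loc_comp
    loc_refl loc_sym loc_trans loc_congr loc_assoc loc_id_l loc_id_r.

Definition loc_functor : functor C localization :=
  @Functor C localization (fun X => X) loc_mor loc_mor_heq
    (fun X => loc_refl (loc_mor (idc X))) loc_mor_comp.

Variables (F : functor C C)
  (FW : forall X Y (f : hom X Y), W f -> W (fmap F f)).

Fixpoint loc_map X Y (f : loc_hom X Y) : loc_hom (F X) (F Y) :=
  match f with
  | loc_mor _ _ f => loc_mor (fmap F f)
  | loc_inv _ _ _ Ww => loc_inv (FW Ww)
  | loc_comp _ _ _ g f => loc_comp (loc_map g) (loc_map f)
  end.

Lemma loc_map_id X : loc_heq (loc_map (loc_mor (idc X))) (loc_mor (idc (F X))).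
Proof. exact: loc_mor_heq (fmap_id F X). Qed.

Lemma loc_map_heq X Y (f g : loc_hom X Y) :
  loc_heq f g -> loc_heq (loc_map f) (loc_map g).
Proof.
elim=> {X Y f g} /=.
- by move=> X Y f; apply: loc_refl.
- by move=> X Y f g _; apply: loc_sym.
- by move=> X Y f g h _ fg _; apply: loc_trans.
- by move=> X Y Z g g' f f' _ gg' _; apply: loc_congr.
- by move=> U X Y Z h g f; apply: loc_assoc.
- move=> X Y f; apply: loc_trans (loc_id_l _).
  exact: loc_congr (loc_map_id Y) (loc_refl _).
- move=> X Y f; apply: loc_trans (loc_id_r _).
  exact: loc_congr (loc_refl _) (loc_map_id X).
- by move=> X Y f g fg; apply: loc_mor_heq; apply: fmap_heq.
- move=> X Y Z g f; apply: loc_trans (loc_mor_comp _ _).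
  exact: loc_mor_heq (fmap_comp F g f).
- move=> X Y w Ww; apply: loc_trans (loc_inv_l _) _.
  exact: loc_sym (loc_map_id X).
- move=> X Y w Ww; apply: loc_trans (loc_inv_r _) _.
  exact: loc_sym (loc_map_id Y).
Qed.

Definition loc_endofunctor : functor localization localization :=
  @Functor localization localization F loc_map loc_map_heq loc_map_id
    (fun X Y Z g f => loc_refl (loc_comp (loc_map g) (loc_map f))).

End Localization.

(* A category with a shift and a class of distinguished triangles.  Of the
   axioms of a triangulated category, only the consequence of the rotation axiom
   that a shift of a distinguished triangle is again distinguished up to signs
   is recorded: this is what makes the shift descend to a Verdier quotient. *)

Record tri_category := TriCategory {
  tcat :> category;
  shift : functor tcat tcat;
  distinguished : forall X Y Z : tcat,
    hom X Y -> hom Y Z -> hom Z (shift X) -> Prop;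
  distinguished_shift : forall X Y Z (f : hom X Y) (g : hom Y Z)
      (h : hom Z (shift X)), distinguished f g h ->
    exists (g' : hom (shift Y) (shift Z)) (h' : hom (shift Z) (shift (shift X))),
      distinguished (fmap shift f) g' h'
}.

Definition triangle_iso (C : category) (S : functor C C)
    (X Y Z : C) (f : hom X Y) (g : hom Y Z) (h : hom Z (S X))
    (X' Y' Z' : C) (f' : hom X' Y') (g' : hom Y' Z') (h' : hom Z' (S X')) :=
  exists (a : hom X X') (b : hom Y Y') (c : hom Z Z'),
    [/\ is_iso a, is_iso b & is_iso c] /\
    [/\ b \oc f ~= f' \oc a, c \oc g ~= g' \oc b
      & fmap S a \oc h ~= h' \oc c].

Lemma is_iso_fmap (C D : category) (F : functor C D) (X Y : C) (f : hom X Y) :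
  is_iso f -> is_iso (fmap F f).
Proof.
move=> [g [gf fg]]; exists (fmap F g); split.
- apply: heq_trans (fmap_id F X); apply: heq_trans (fmap_heq F gf).
  exact: heq_sym (fmap_comp F g f).
- apply: heq_trans (fmap_id F Y); apply: heq_trans (fmap_heq F fg).
  exact: heq_sym (fmap_comp F f g).
Qed.

(* A square of isomorphisms extends to an isomorphism of triangles. *)
Lemma triangle_iso_complete (C : category) (S : functor C C)
    (X Y Z X' Y' Z' : C) (f : hom X Y) (f' : hom X' Y') (g' : hom Y' Z')
    (h' : hom Z' (S X')) (a : hom X X') (b : hom Y Y') (c : hom Z Z') :
  is_iso a -> is_iso b -> is_iso c -> b \oc f ~= f' \oc a ->
  exists (g : hom Y Z) (h : hom Z (S X)), triangle_iso f g h f' g' h'.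
Proof.
move=> ia ib ic bf.
have [a' [a'a aa']] := is_iso_fmap S ia; have [c' [c'c cc']] := ic.
exists (c' \oc (g' \oc b)), (a' \oc (h' \oc c)), a, b, c.
split=> //; split=> //; apply: heq_trans (compcA _ _ _) _.
- by apply: heq_trans (heq_comp cc' (heq_refl _)) _; apply: compc1f.
- by apply: heq_trans (heq_comp aa' (heq_refl _)) _; apply: compc1f.
Qed.

Lemma fmap_square (C D : category) (F : functor C D) (X Y X' Y' : C)
    (f : hom X Y) (f' : hom X' Y') (a : hom X X') (b : hom Y Y') :
  b \oc f ~= f' \oc a ->
  fmap F b \oc fmap F f ~= fmap F f' \oc fmap F a.
Proof.
move=> bf; apply: heq_trans (fmap_comp F f' a).
apply: heq_trans (fmap_heq F bf); exact: heq_sym (fmap_comp F b f).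
Qed.

(* The Verdier quotient T / S by a class S of objects closed under the shift:
   the localization at the morphisms whose cone is in S, with the triangles
   isomorphic to images of distinguished triangles of T. *)

Section VerdierQuotient.
Variables (T : tri_category) (S : T -> Prop).
Hypothesis S_shift : forall X, S X -> S (shift T X).

Definition cone_in_class (X Y : T) (f : hom X Y) : Prop :=
  exists (Z : T) (g : hom Y Z) (h : hom Z (shift T X)),
    distinguished f g h /\ S Z.

Lemma cone_in_class_shift (X Y : T) (f : hom X Y) :
  cone_in_class f -> cone_in_class (fmap (shift T) f).
Proof.
move=> [Z [g [h [fgh SZ]]]]; have [g' [h' fgh']] := distinguished_shift fgh.
by exists (shift T Z), g', h'; split; last exact: S_shift.
Qed.

Definition vcat : category := localization cone_in_class.

Definition vfunctor : functor T vcat := loc_functor cone_in_class.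

Definition vshift : functor vcat vcat := loc_endofunctor cone_in_class_shift.

Definition vdistinguished (X Y Z : vcat) (f : hom X Y) (g : hom Y Z)
    (h : hom Z (vshift X)) : Prop :=
  exists (X' Y' Z' : T) (f' : hom X' Y') (g' : hom Y' Z')
      (h' : hom Z' (shift T X')),
    distinguished f' g' h' /\
    triangle_iso (S := vshift) f g h
      (fmap vfunctor f') (fmap vfunctor g') (fmap vfunctor h').

Lemma vdistinguished_shift (X Y Z : vcat) (f : hom X Y) (g : hom Y Z)
    (h : hom Z (vshift X)) : vdistinguished f g h ->
  exists (g' : hom (vshift Y) (vshift Z))
      (h' : hom (vshift Z) (vshift (vshift X))),
    vdistinguished (fmap vshift f) g' h'.
Proof.
move=> [X' [Y' [Z' [f' [g' [h' [fgh']]]]]]].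
move=> [a [b [c [[ia ib ic] [bf _ _]]]]].
have [g2 [h2 fgh2]] := distinguished_shift fgh'.
have [g1 [h1 fgh1]] := @triangle_iso_complete vcat vshift _ _ _
  (shift T X') (shift T Y') (shift T Z') (fmap vshift f)
  (fmap vshift (fmap vfunctor f')) (fmap vfunctor g2) (fmap vfunctor h2) _ _ _ (is_iso_fmap vshift ia)
  (is_iso_fmap vshift ib) (is_iso_fmap vshift ic) (fmap_square vshift bf).
by exists g1, h1, _, _, _, (fmap (shift T) f'), g2, h2.
Qed.

Definition verdier : tri_category :=
  @TriCategory vcat vshift vdistinguished vdistinguished_shift.

End VerdierQuotient.

Section HomotopyCategory.
Variable A : additive_category.

Record bcomplex := BComplex {
  bcx :> cochain_complex A;
  bcxP : bounded bcx
}.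

Lemma heq_of_eq (X Y : cochain_complex A) (f g : chain_map X Y) :
  (forall n, f n = g n) -> homotopic f g.
Proof.
move=> fg; exists (fun n => 0) => n.
by rewrite fg subrr acomp0l acomp0r addr0.
Qed.

Lemma chain_compA_subproof (W X Y Z : bcomplex) (h : chain_map Y Z)
    (g : chain_map X Y) (f : chain_map W X) :
  homotopic (chain_comp h (chain_comp g f)) (chain_comp (chain_comp h g) f).
Proof. by apply: heq_of_eq => n /=; rewrite acompA. Qed.

Lemma chain_comp1f_subproof (X Y : bcomplex) (f : chain_map X Y) :
  homotopic (chain_comp (chain_id Y) f) f.
Proof. by apply: heq_of_eq => n /=; rewrite acomp1f. Qed.

Lemma chain_compf1_subproof (X Y : bcomplex) (f : chain_map X Y) :
  homotopic (chain_comp f (chain_id X)) f.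
Proof. by apply: heq_of_eq => n /=; rewrite acompf1. Qed.

Definition Kb_cat : category :=
  @Category bcomplex (fun X Y => chain_map X Y) (fun X Y => @homotopic A X Y)
    (fun X => chain_id X) (fun X Y Z => @chain_comp A X Y Z)
    (fun X Y => @homotopic_refl A X Y) (fun X Y => @homotopic_sym A X Y)
    (fun X Y => @homotopic_trans A X Y) (fun X Y Z => @homotopic_comp A X Y Z)
    chain_compA_subproof chain_comp1f_subproof chain_compf1_subproof.

Definition bshift (X : bcomplex) : bcomplex :=
  BComplex (bounded_shift (bcxP X)).

Definition bcone (X Y : bcomplex) (f : chain_map X Y) : bcomplex :=
  BComplex (bounded_cone f (bcxP X) (bcxP Y)).

Lemma Kb_shift_heq (X Y : bcomplex) (f g : chain_map X Y) :
  homotopic f g -> homotopic (shiftc_map f) (shiftc_map g).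
Proof.
move=> [s sP]; exists (fun n => - s (n + 1)) => n.
by rewrite /= sP !(acompNl, acompNr) !opprK.
Qed.

Definition Kb_shift : functor Kb_cat Kb_cat :=
  @Functor Kb_cat Kb_cat bshift
    (fun X Y (f : chain_map X Y) => shiftc_map f) Kb_shift_heq
    (fun X => heq_of_eq (fun n => erefl))
    (fun X Y Z g f => heq_of_eq (fun n => erefl)).

Definition Kb_distinguished (X Y Z : Kb_cat) (f : hom X Y) (g : hom Y Z)
    (h : hom Z (Kb_shift X)) : Prop :=
  exists (X' Y' : bcomplex) (f' : chain_map X' Y'),
    @triangle_iso Kb_cat Kb_shift X Y Z f g h
      X' Y' (bcone f') f' (cone_in f') (cone_out f').

Definition shift_cone_map (X Y : cochain_complex A) (n : int) :
    ahom (abip (X (n + 1 + 1)) (Y (n + 1))) (abip (X (n + 1 + 1)) (Y (n + 1))) :=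
  ain2 _ _ \oa apr2 _ _ - ain1 _ _ \oa apr1 _ _.

Lemma shift_cone_mapK X Y n :
  shift_cone_map X Y n \oa shift_cone_map X Y n = aid _.
Proof.
rewrite /shift_cone_map acompDl !acompDr !acompNl !acompNr -!acompA.
rewrite !(acompA (apr1 _ _)) !(acompA (apr2 _ _)).
rewrite apr1_in1 apr2_in2 apr1_in2 apr2_in1 !acomp1f !acomp0l !acomp0r.
by rewrite !oppr0 opprK addr0 add0r [LHS]addrC abip_id.
Qed.

Lemma apr1_shift_cone_map X Y n :
  apr1 _ _ \oa shift_cone_map X Y n = - apr1 _ _.
Proof.
by rewrite acompDr acompNr !acompA apr1_in1 apr1_in2 acomp0l add0r acomp1f.
Qed.

Lemma apr2_shift_cone_map X Y n :
  apr2 _ _ \oa shift_cone_map X Y n = apr2 _ _.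
Proof.
by rewrite acompDr acompNr !acompA apr2_in1 apr2_in2 acomp0l subr0 acomp1f.
Qed.

Lemma shift_cone_subproof X Y (f : chain_map X Y) n :
  shift_cone_map X Y (n + 1) \oa cdiff (shiftc (cone f)) n
  = cdiff (cone (shiftc_map f)) n \oa shift_cone_map X Y n.
Proof.
rewrite acompDl acompNl acompNr -!acompA !acompNr opprK.
rewrite apr1_cone_diff apr2_cone_diff.
rewrite /= /cone_diff /= /shiftc_diff /= [RHS]acompDl -!acompA.
rewrite [X in _ = _ + _ \oa X]acompDl -!acompA.
rewrite apr1_shift_cone_map apr2_shift_cone_map.
by rewrite [LHS]addrC !(acompNl, acompNr) !opprK !acompDr !acompNr opprD.
Qed.

Lemma shift_cone_subproof' X Y (f : chain_map X Y) n :
  shift_cone_map X Y (n + 1) \oa cdiff (cone (shiftc_map f)) n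
  = cdiff (shiftc (cone f)) n \oa shift_cone_map X Y n.
Proof.
rewrite -[LHS]acompf1 -[in LHS]shift_cone_mapK acompA -(acompA _ (cdiff _ _)).
by rewrite -shift_cone_subproof acompA shift_cone_mapK acomp1f.
Qed.

Lemma Kb_distinguished_shift (X Y Z : Kb_cat) (f : hom X Y) (g : hom Y Z)
    (h : hom Z (Kb_shift X)) : Kb_distinguished f g h ->
  exists (g' : hom (Kb_shift Y) (Kb_shift Z))
      (h' : hom (Kb_shift Z) (Kb_shift (Kb_shift X))),
    Kb_distinguished (fmap Kb_shift f) g' h'.
Proof.
move=> [X' [Y' [f' [a [b [c [[ia ib ic] [bf _ _]]]]]]]].
pose sf : chain_map (bshift X') (bshift Y') := shiftc_map f'.
pose r : @hom Kb_cat (bshift (bcone f')) (bcone sf) :=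
  @ChainMap A (bshift (bcone f')) (bcone sf) (shift_cone_map X' Y')
    (shift_cone_subproof f').
pose r' : @hom Kb_cat (bcone sf) (bshift (bcone f')) :=
  @ChainMap A (bcone sf) (bshift (bcone f')) (shift_cone_map X' Y')
    (shift_cone_subproof' f').
have ir : is_iso r.
  by exists r'; split; apply: heq_of_eq => n; apply: shift_cone_mapK.
have irc : is_iso (r \oc fmap Kb_shift c).
  exact: is_iso_comp (is_iso_fmap Kb_shift ic).
have [g1 [h1 t]] := @triangle_iso_complete Kb_cat Kb_shift _ _ _
  (bshift X') (bshift Y') (bcone sf)
  (fmap Kb_shift f) sf (cone_in sf) (cone_out sf) _ _ _
  (is_iso_fmap Kb_shift ia) (is_iso_fmap Kb_shift ib) irc
  (fmap_square Kb_shift bf).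
by exists g1, h1, (bshift X'), (bshift Y'), sf.
Qed.

Definition Kb : tri_category :=
  @TriCategory Kb_cat Kb_shift Kb_distinguished Kb_distinguished_shift.

End HomotopyCategory.

Section PureSingularity.
Variables (L : Type) (A : additive_category).

(* Testing against all pure projective objects covers the presentable ones, by
   presentable_pure_projective; acyclic complexes are thus exact under
   Hom (P, -) for every pure projective P without assuming that presentables generate. *)
Definition pure_acyclic (X : cochain_complex A) : Prop :=
  forall P : A, pure_projective L P -> forall n,
    exact_at (fun u : ahom P (X n) => cdiff X n \oa u)
             (fun u : ahom P (X (n + 1)) => cdiff X (n + 1) \oa u).

Definition pure_quasi_iso (X Y : cochain_complex A) (f : chain_map X Y) : Prop :=
  pure_acyclic (cone f).

Definition pure_projective_terms (X : cochain_complex A) : Prop :=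
  forall n, pure_projective L (X n).

Lemma pure_acyclic_shift (X : Kb A) : pure_acyclic X -> pure_acyclic (shift _ X).
Proof.
move=> aX P PP n v /=; rewrite acompNl.
split=> [/eqP|[u <-]].
  rewrite oppr_eq0 => /eqP/(aX P PP (n + 1))[u <-].
  by exists (- u); rewrite acompNl acompNr opprK.
apply/eqP; rewrite oppr_eq0 acompNl acompNr oppr_eq0; apply/eqP.
by apply/(aX P PP (n + 1)); exists u.
Qed.

Definition Db : tri_category :=
  @verdier (Kb A) (fun X => pure_acyclic X) pure_acyclic_shift.

Lemma pure_projective_shift (X : Db) :
  pure_projective_terms X -> pure_projective_terms (shift _ X).
Proof. by move=> PX n; apply: PX. Qed.

Definition Dsg : tri_category :=
  @verdier Db (fun X => pure_projective_terms X) pure_projective_shift.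

Definition pure_pd_le (X : cochain_complex A) (n : int) : Prop :=
  exists (P : cochain_complex A) (f : chain_map P X),
    [/\ pure_projective_terms P, pure_quasi_iso f
      & forall i : int, i < - n -> is_zero (P i)].

(* The supremum of the dimensions of all objects is < oo. *)
Definition finite_pure_gldim : Prop :=
  exists n : int, forall M : A, pure_pd_le (stalk M) n.

End PureSingularity.

(* Main.v *)
From HB Require Import structures.
From mathcomp Require Import all_boot all_order all_algebra.
From mathcomp Require Import boolp classical_sets functions cardinality.
Require Import Defs.

(* Write PP for the class of pure projective objects.  Every object has a
   PP-precover, so bounded above complexes have PP-resolutions, unique up to
   homotopy; let pure_dim_le k M mean that M has a PP-resolution of length k,
   where, by a relative form of Schanuel's lemma, any resolution may be tested.

   If the dimensions are bounded by k, then the cocycles of a resolution Q of a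
   bounded complex X are in PP in low degrees.  Truncating Q there, X becomes
   isomorphic in D^b to a bounded complex with terms in PP, which is killed in the
   singularity category.

   Conversely, sending X to the germ at - oo of its resolution inverts both the
   pure quasi-isomorphisms and the morphisms with cone in K^b(PP), so it factors
   through the singularity category.  If the latter is zero, then the resolution
   of every object M is contractible in low degrees, which makes its cocycles
   there retracts of its terms, so that M has finite dimension.  The bound is
   uniform: otherwise, a countable coproduct of objects of growing dimensions
   would have infinite dimension. *)

(** Presentable objects need not generate [A], so a precover need not be an epimorphism. Hence
    exactness is always tested on maps out of pure projectives, syzygies are kernels, and a
    truncation adds an object of cocycles instead of a cokernel.

    Precovers are the hard input. Pure projectives form a proper class, and presentables are bounded
    only through a generator G: regularity of [L] makes the small subsets of Hom(G, F) directed, and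
    exactness of directed colimits then presents a presentable F as a quotient of a coproduct of
    copies of G indexed by [L].

    Morphisms of the quotients are formal words modulo a generated congruence, and a functor is what
    tells two of them apart. Germs at - oo are a target chosen to kill K^b(PP): a bounded complex
    with terms in PP is its own resolution, and a bounded complex has a zero germ. Having terms in
    PP is not invariant under isomorphism, whereas contractibility of the germ is; it is the latter
    that is carried along isomorphisms of triangles. *)

Set Implicit Arguments.
Unset Strict Implicit.
Unset Printing Implicit Defensive.

Import Order.TTheory GRing.Theory Num.Theory.
Local Open Scope classical_set_scope.
Local Open Scope ring_scope.

(* Equalities in abelian groups by reflection: both sides are integer
   combinations of the same atoms. *)
Inductive zexp := Zatom of nat | Zzero | Zadd of zexp & zexp | Zopp of zexp.

Fixpoint zeval (V : zmodType) (env : seq V) (e : zexp) : V :=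
  match e with
  | Zatom i => nth 0 env i
  | Zzero => 0
  | Zadd a b => zeval env a + zeval env b
  | Zopp a => - zeval env a
  end.

Fixpoint zcoef (e : zexp) (i : nat) : int :=
  match e with
  | Zatom j => (i == j)%:R
  | Zzero => 0
  | Zadd a b => zcoef a i + zcoef b i
  | Zopp a => - zcoef a i
  end.

Lemma zevalE (V : zmodType) (env : seq V) e :
  zeval env e = \sum_(i < size env) nth 0 env i *~ zcoef e i.
Proof.
elim: e => /= [j||a -> b ->|a ->].
- have [ltj|gej] := ltnP j (size env).
    rewrite (bigD1 (Ordinal ltj)) //= eqxx mulr1z big1 ?addr0 // => i.
    by rewrite -val_eqE /= => /negPf->; rewrite mulr0z.
  rewrite nth_default // big1 // => i _.
  by rewrite ltn_eqF ?mulr0z // (leq_trans (ltn_ord i)).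
- by rewrite big1 // => i _; rewrite mulr0z.
- by rewrite -big_split /=; apply: eq_bigr => i _; rewrite mulrzDr.
- by rewrite -sumrN; apply: eq_bigr => i _; rewrite mulrNz.
Qed.

Lemma zmod_eq (V : zmodType) (env : seq V) a b :
  all (fun i => zcoef a i == zcoef b i) (iota 0 (size env)) ->
  zeval env a = zeval env b.
Proof.
move=> /allP ab; rewrite !zevalE; apply: eq_bigr => i _; congr (_ *~ _).
by apply/eqP/ab; rewrite mem_iota /= ltn_ord.
Qed.

(* Atoms are compared up to conversion, as the instances hidden in degrees such
   as n + 1 are not always syntactically equal. *)
Ltac zmod_insert x env :=
  match env with
  | context [cons ?y _] => let _ := match goal with _ => unify x y end in env
  | _ => constr:(cons x env)
  end.

Ltac zmod_atoms t env :=
  lazymatch t with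
  | ?a + ?b => let env := zmod_atoms a env in zmod_atoms b env
  | - ?a => zmod_atoms a env
  | 0 => env
  | _ => zmod_insert t env
  end.

Ltac zmod_index x env :=
  match env with
  | cons ?y _ => let _ := match goal with _ => unify x y end in constr:(0%N)
  | cons _ ?env => let i := zmod_index x env in constr:(i.+1)
  end.

Ltac zmod_quote t env :=
  lazymatch t with
  | ?a + ?b => let a := zmod_quote a env in let b := zmod_quote b env in
      constr:(Zadd a b)
  | - ?a => let a := zmod_quote a env in constr:(Zopp a)
  | 0 => constr:(Zzero)
  | _ => let i := zmod_index t env in constr:(Zatom i)
  end.

Ltac zmod :=
  lazymatch goal with
  | |- @eq ?T ?s ?t =>
    let env := zmod_atoms s (@nil T) in
    let env := zmod_atoms t env in
    let a := zmod_quote s env in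
    let b := zmod_quote t env in
    refine (@zmod_eq _ env a b _); vm_compute; reflexivity
  end.

(** Lets a proof by [zmod] use one hypothesis [c = d]: what remains is a formal identity. *)
Lemma zmod_lin (V : zmodType) (a b c d : V) : c = d -> a - b = c - d -> a = b.
Proof. by move=> -> /eqP; rewrite subrr subr_eq0 => /eqP. Qed.

Lemma zmod_add (V : zmodType) (a b c d : V) : a = b -> c = d -> a + c = b + d.
Proof. by move=> -> ->. Qed.

Definition acompE := (acompA, acompDl, acompDr, acompNl, acompNr, acomp0l,
  acomp0r, acomp1f, acompf1).

Tactic Notation "zmod_from" constr(E) :=
  first [refine (zmod_lin E _); zmod | refine (zmod_lin (esym E) _); zmod].

(** * Cardinals and directed posets *)

Lemma card_le_injP (T U : Type) (A : set T) (B : set U) :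
  (A #<= B)%card <-> exists f : A -> B, injective f.
Proof.
split=> [/card_leP/injfunPex[f _ f_inj]|[f f_inj]].
  by exists f => x y; apply: f_inj; rewrite inE.
by apply/card_leP/injfunPex; exists f => // x y _ _; apply: f_inj.
Qed.

(** Zorn's lemma on graphs of partial bijections: a maximal graph is defined on all of [A] or
    reaches all of [B], as otherwise one more pair could be added. *)
Lemma card_le_total (T U : Type) (A : set T) (B : set U) :
  (A #<= B)%card \/ (B #<= A)%card.
Proof.
pose P : set (set (A * B)) := [set G | forall p q, G p -> G q ->
  (p.1 = q.1 <-> p.2 = q.2)].
have [F FP totF|G [PG maxG]] := @Zorn_bigcup (A * B)%type P.
  move=> p q [X FX Xp] [Y FY Yq].
  have [XY|YX] := totF _ _ FX FY; first exact: (FP _ FY) (XY _ Xp) Yq.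
  exact: (FP _ FX) Xp (YX _ Yq).
have [domG|/existsNP[a nGa]] := pselect (forall a, exists b, G (a, b)).
  left; apply/card_le_injP; have [f fG] := choice domG.
  by exists f => a a' faa'; apply/(PG _ _ (fG a) (fG a')).
have [ranG|/existsNP[b nGb]] := pselect (forall b, exists a, G (a, b)).
  right; apply/card_le_injP; have [f fG] := choice ranG.
  by exists f => b b' fbb'; apply/(PG _ _ (fG b) (fG b')).
case: (maxG (G `|` [set (a, b)])).
  split=> [p Gp|]; first by left.
  by move=> /(_ (a, b) (or_intror erefl)) Gab; apply: nGa; exists b.
have nG p : G p -> (p.1 <> a) /\ (p.2 <> b).
  case: p => x y Gxy /=.
  by split=> e; [apply: nGa; exists y|apply: nGb; exists x]; rewrite -e.
move=> p q [Gp|->] [Gq|->] /=; first exact: PG.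
- by have [? ?] := nG _ Gp.
- by have [na nb] := nG _ Gq; split=> e; [case: na|case: nb].
- by [].
Qed.

Lemma directed_nat (L : Type) (disp : Order.disp_t) (I : porderType disp) :
  infinite_set [set: L] -> directed L I -> directed nat I.
Proof.
move=> /infiniteP natL dirI S [Snat nSnat]; apply: dirI; split.
  exact: card_le_trans natL.
by move=> LS; apply: nSnat; apply: card_le_trans LS.
Qed.

Section Directed.
Variables (disp : Order.disp_t) (I : porderType disp).
Hypothesis dirI : directed nat I.

Lemma directed_finite (S : set I) : finite_set S ->
  exists u, forall i, S i -> (i <= u)%O.
Proof.
move=> finS; apply: dirI; split.
  by have [n /card_eqPle[Sn _]] := finS; apply: card_le_trans Sn (card_leT _).
by move=> /infiniteP.
Qed.

Lemma directed_inhabited : exists i : I, True.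
Proof. by have [i _] := directed_finite (@finite_set0 I); exists i. Qed.

Lemma directed_pair (i j : I) : exists k, (i <= k)%O /\ (j <= k)%O.
Proof.
have [k kP] := directed_finite (finite_set2 i j).
by exists k; split; apply: kP; [left|right].
Qed.

End Directed.

Section SmallSets.
Variables L H : Type.

(** By [card_le_total] these are the subsets of cardinality less than |L|; the boolean condition
    makes them a subtype, which inherits the inclusion order. *)
Definition small_set := {S : set H | `[< ~ ([set: L] #<= S)%card >]}.

HB.instance Definition _ := SubChoice.on small_set.
HB.instance Definition _ :=
  [SubChoice_isSubPOrder of small_set by <: with set_display].

Lemma small_setP (S : small_set) : ~ ([set: L] #<= val S)%card.
Proof. by apply/asboolP; case: S. Qed.

Lemma small_set_le (S T : small_set) : (S <= T)%O <-> val S `<=` val T.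
Proof. by rewrite -subsetEset. Qed.

(* By regularity the union of fewer than |L| small sets is small: an injection
   of L into it would pull back to a decomposition of L itself. *)
Lemma small_set_directed : infinite_regular L -> directed L small_set.
Proof.
move=> [_ regL] F [FL nLF].
have bigF : ~ ([set: L] #<= \bigcup_(S in F) val S)%card.
  move=> /card_le_injP[f f_inj].
  pose g (l : L) : H := val (f (exist _ l (mem_set I))).
  have g_inj : injective g by move=> l l' /val_inj/f_inj[].
  apply: (regL F (fun S => g @^-1` val (val S))).
  - split; first by apply: card_le_trans FL; have /card_eqPle[] := card_setT F.
    by move=> LF; apply: nLF; apply: card_le_trans LF _;
      have /card_eqPle[] := card_setT F.
  - move=> S; split; first exact: card_leT.
    move=> LS; apply: (@small_setP (val S)).
    apply: card_le_trans LS _; apply/card_le_injP.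
    exists (fun l : g @^-1` val (val S) =>
      exist _ (g (val l)) (mem_set (set_mem (valP l)))).
    by move=> l l' [] /g_inj /val_inj.
  - apply/seteqP; split=> // l _.
    have [S FS Sl] := set_mem (valP (f (exist _ l (mem_set I)))).
    by exists (exist _ S (mem_set FS)).
exists (exist _ (\bigcup_(S in F) val S) (asboolT bigF)) => S FS.
by apply/small_set_le => h Sh /=; exists S.
Qed.

Definition small1 (Linf : infinite_set [set: L]) (h : H) : small_set.
Proof.
exists [set h]; apply/asboolP => Lh.
by apply: Linf; apply: card_le_finite Lh (finite_set1 h).
Defined.

End SmallSets.

(** * Abelian categories *)

Section Universal.
Variable A : additive_category.
Implicit Types W X Y Z : A.

Lemma to_zero W X (f : ahom W X) : is_zero X -> f = 0.
Proof. by move=> X0; rewrite -[f]acomp1f X0 acomp0l. Qed.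

Lemma from_zero W X (f : ahom X W) : is_zero X -> f = 0.
Proof. by move=> X0; rewrite -[f]acompf1 X0 acomp0r. Qed.

Lemma kernel_mono X Y Z (k : ahom X Y) (g : ahom Y Z) :
  is_kernel k g -> mono k.
Proof.
move=> [gk kP] W u v kuv.
have [|w [_ wP]] := kP W (k \oa v); first by rewrite acompA gk acomp0l.
by rewrite -(wP u kuv) -(wP v erefl).
Qed.

Lemma kernel_lift X Y Z (k : ahom X Y) (g : ahom Y Z) : is_kernel k g ->
  forall W (u : ahom W Y), g \oa u = 0 -> {v : ahom W X | k \oa v = u}.
Proof. by move=> [_ kP] W u /kP/cid[v [kv _]]; exists v. Qed.

Lemma cokernel_epi X Y Z (c : ahom Y Z) (f : ahom X Y) :
  is_cokernel c f -> epi c.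
Proof.
move=> [cf cP] W u v uvc.
have [|w [_ wP]] := cP W (v \oa c); first by rewrite -acompA cf acomp0r.
by rewrite -(wP u uvc) -(wP v erefl).
Qed.

Lemma cokernel_lift X Y Z (c : ahom Y Z) (f : ahom X Y) : is_cokernel c f ->
  forall W (u : ahom Y W), u \oa f = 0 -> {v : ahom Z W | v \oa c = u}.
Proof. by move=> [_ cP] W u /cP/cid[v [cv _]]; exists v. Qed.

Lemma is_cokernel_of_kernel K X Y Z (k : ahom K Y) (c : ahom Y Z)
    (f : ahom X Y) : is_cokernel c f -> is_kernel k c -> is_cokernel c k.
Proof.
move=> cf kc; split=> [|W u uk]; first by case: kc.
have [v vP] := kernel_lift kc (proj1 cf); apply: (proj2 cf).
by rewrite -vP acompA uk acomp0l.
Qed.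

Lemma abip_comp W X Y Z (r : ahom (abip X Y) Z) (s : ahom W (abip X Y)) :
  r \oa ain1 X Y \oa (apr1 X Y \oa s) + r \oa ain2 X Y \oa (apr2 X Y \oa s)
  = r \oa s.
Proof. by rewrite !acompA -acompDl -!acompA -acompDr abip_id acompf1. Qed.

Lemma abip_row_col W X Y Z (f : ahom X Z) (g : ahom Y Z) (a : ahom W X)
    (b : ahom W Y) :
  (f \oa apr1 X Y + g \oa apr2 X Y) \oa (ain1 X Y \oa a + ain2 X Y \oa b)
  = f \oa a + g \oa b.
Proof.
rewrite acompDl !acompDr -!acompA !(acompA (apr1 _ _)).
rewrite !(acompA (apr2 _ _)) apr1_in1 apr1_in2 apr2_in1 apr2_in2.
by rewrite !acomp1f !acomp0l !acomp0r addr0 add0r.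
Qed.

Definition is_coproduct (I : Type) (X : I -> A) C (c : forall i, ahom (X i) C) :=
  forall W (w : forall i, ahom (X i) W),
    exists! u : ahom C W, forall i, u \oa c i = w i.

Section Coproduct.
Variables (I : Type) (X : I -> A) (C : A) (c : forall i, ahom (X i) C).
Hypothesis cP : is_coproduct c.

Lemma coproduct_lift W (w : forall i, ahom (X i) W) :
  {u : ahom C W | forall i, u \oa c i = w i}.
Proof. by have /cid[u [uP _]] := cP w; exists u. Qed.

Lemma coproduct_eq W (u v : ahom C W) :
  (forall i, u \oa c i = v \oa c i) -> u = v.
Proof.
move=> uv; have [w [_ wP]] := cP (fun i => v \oa c i).
by rewrite -(wP _ uv) -(wP v).
Qed.

Lemma coproduct_pure_projective (L : Type) :
  (forall i, pure_projective L (X i)) -> pure_projective L C.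
Proof.
move=> PX Y Y' Y'' f g fg h.
have /all_sig[h' h'P] : forall i, {h' | g \oa h' = h \oa c i}.
  by move=> i; apply/cid/(PX i) => //; apply: fg.
have [u uP] := coproduct_lift h'; exists u; apply: coproduct_eq => i.
by rewrite -acompA uP h'P.
Qed.

End Coproduct.

(** The colimit is a cokernel: over all pairs i <= j, the copy of [D i] in the coproduct is
    identified with its image in the copy of [D j]. *)
Lemma colimit_ex : abelian A -> has_coproducts A ->
  forall (disp : Order.disp_t) (I : porderType disp) (D : diagram A I),
  exists C (c : forall i, ahom (D i) C), is_colimit c.
Proof.
move=> [_ coker_ex _ _] cop disp I D.
have [S [s sP]] := cop I D.
pose J := {ij : I * I | (ij.1 <= ij.2)%O}.
have [R [r rP]] := cop J (fun ij => D (sval ij).1).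
pose dS (ij : J) : ahom (D (sval ij).1) S :=
  s (sval ij).2 \oa dmor D (proj2_sig ij) - s (sval ij).1.
have [d dP] := coproduct_lift rP dS.
have [C [q qP]] := coker_ex _ _ d; exists C, (fun i => q \oa s i).
split=> [i j le_ij|W w wP].
  apply/eqP; rewrite -subr_eq0 -acompA -acompNr -acompDr; apply/eqP.
  have := dP (exist _ (i, j) le_ij); rewrite /dS /= => <-.
  by rewrite acompA (proj1 qP) acomp0l.
have [u uP] := coproduct_lift sP w.
have [|v vP] := cokernel_lift qP (u := u).
  apply: (coproduct_eq rP) => ij; rewrite -acompA dP acompDr acompNr acompA.
  by rewrite !uP wP subrr acomp0l.
exists v; split=> [i|v' v'P]; first by rewrite acompA vP uP.
apply: (cokernel_epi qP); rewrite vP; apply: (coproduct_eq sP) => i.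
by rewrite uP -v'P acompA.
Qed.

(* t \oa p' is the factorization of p through its image, the kernel of its
   cokernel. *)
Lemma image_ex X Y (p : ahom X Y) : abelian A ->
  exists T (p' : ahom X T) (t : ahom T Y) Z (c : ahom Y Z),
    [/\ p = t \oa p', epi p', is_cokernel c p & is_kernel t c].
Proof.
move=> [ker_ex coker_ex mono_ker _].
have [Z [c cP]] := coker_ex _ _ p; have [T [t tP]] := ker_ex _ _ c.
have [p' p'P] := kernel_lift tP (proj1 cP).
exists T, p', t, Z, c; split=> //.
suff epi0 W (w : ahom T W) : w \oa p' = 0 -> w = 0.
  move=> W u v uv; apply/eqP; rewrite -subr_eq0; apply/eqP/epi0.
  by rewrite acompDl acompNl uv subrr.
(* As [w] kills [p'], [p] factors through the mono [t \oa k], the kernel of some [g]. Then [g] kills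
   [p], so it factors through [c] and kills [t]. Thus [t] factors through [t \oa k], [k] has a
   section, and [w = 0]. *)
move=> wp'; have [T' [k kP]] := ker_ex _ _ w.
have [p2 p2P] := kernel_lift kP wp'.
have [|V [g gP]] := mono_ker _ _ (t \oa k).
  by move=> U u v; rewrite -!acompA => /(kernel_mono tP)/(kernel_mono kP).
have [|g' g'P] := cokernel_lift cP (u := g).
  by rewrite -p'P -p2P acompA acompA -[_ \oa t \oa k]acompA (proj1 gP) acomp0l.
have [|v vP] := kernel_lift gP (u := t).
  by rewrite -g'P -acompA (proj1 tP) acomp0r.
have kv : k \oa v = aid T.
  by apply: (kernel_mono tP); rewrite acompA vP acompf1.
by rewrite -[w]acompf1 -kv acompA (proj1 kP) acomp0l.
Qed.

End Universal.

(** * Presentable objects *)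

Section PresentableCover.
Variables (L : Type) (A : additive_category).
Hypotheses (hL : infinite_regular L) (hA : grothendieck A).

(** Used for the image of a set of maps from the generator and for the quotient of [F] by it. *)
Record span (F : A) := Span {
  spanK : A; spanC : A; span_in : ahom spanK F; span_out : ahom F spanC
}.

Lemma subset_span (G F : A) (S : set (ahom G F)) : exists q : span F,
  [/\ short_exact (span_in q) (span_out q),
      forall h, S h -> span_out q \oa h = 0
    & forall W (w : ahom F W), (forall h, S h -> w \oa h = 0) ->
        exists v, v \oa span_out q = w].
Proof.
have [[ker_ex coker_ex _ _] cop _ _] := hA.
have [P [i iP]] := cop S (fun => G).
have [p pP] := coproduct_lift iP (fun h : S => val h).
have [C [c cP]] := coker_ex _ _ p; have [K [k kP]] := ker_ex _ _ c.
exists (Span k c); split=> /= [|h Sh|W w wS].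
- by split=> //; apply: is_cokernel_of_kernel cP kP.
- have := pP (exist _ h (mem_set Sh)); rewrite /= => <-.
  by rewrite acompA (proj1 cP) acomp0l.
- have [|v vP] := cokernel_lift cP (u := w); last by exists v.
  apply: (coproduct_eq iP) => h; rewrite -acompA pP acomp0l.
  exact: wS (set_mem (valP h)).
Qed.

Lemma generator_eq (G X Y : A) (w : ahom X Y) : is_generator G ->
  (forall h : ahom G X, w \oa h = 0) -> w = 0.
Proof.
move=> genG wG; apply: contrapT => /genG[h]; apply.
by rewrite wG acomp0l.
Qed.

(* F is the directed colimit of the images of the maps from coproducts of fewer
   than |L| copies of G, so that the identity of F factors through one image. *)
Lemma presentable_cover_small (G F : A) : is_generator G -> presentable L F ->
  exists S : small_set L (ahom G F), forall W (w : ahom F W),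
    (forall h, val S h -> w \oa h = 0) -> w = 0.
Proof.
move=> genG presF; have [abA cop AB5 _] := hA.
have dirL := @small_set_directed L (ahom G F) hL.
have dirN := directed_nat (proj1 hL) dirL.
pose I := small_set L (ahom G F).
have /all_sig[q qP] : forall S : I, {q : span F | [/\
      short_exact (span_in q) (span_out q),
      forall h, val S h -> span_out q \oa h = 0
    & forall W (w : ahom F W), (forall h, val S h -> w \oa h = 0) ->
        exists v, v \oa span_out q = w]}.
  by move=> S; apply: cid; apply: subset_span.
have kP S : is_kernel (span_in (q S)) (span_out (q S)).
  by have [[]] := qP S.
have cP S : is_cokernel (span_out (q S)) (span_in (q S)).
  by have [[]] := qP S.
have out_in (S T : I) : (S <= T)%O -> span_out (q T) \oa span_in (q S) = 0.
  move=> /small_set_le ST; have [_ _ /(_ _ (span_out (q T)))[h Sh|v <-]] := qP S.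
    by have [_ + _] := qP T; apply; apply: ST.
  by rewrite -acompA (proj1 (kP S)) acomp0r.
pose dK (S T : I) (ST : (S <= T)%O) := kernel_lift (kP T) (out_in S T ST).
pose dC (S T : I) (ST : (S <= T)%O) := cokernel_lift (cP S) (out_in S T ST).
have dK_id S (le_SS : (S <= S)%O) : sval (dK S S le_SS) = aid _.
  by apply: (kernel_mono (kP S)); rewrite (svalP (dK _ _ _)) acompf1.
have dK_comp S T U (ST : (S <= T)%O) (TU : (T <= U)%O) (SU : (S <= U)%O) :
    sval (dK T U TU) \oa sval (dK S T ST) = sval (dK S U SU).
  by apply: (kernel_mono (kP U)); rewrite acompA !(svalP (dK _ _ _)).
have dC_id S (le_SS : (S <= S)%O) : sval (dC S S le_SS) = aid _.
  by apply: (cokernel_epi (cP S)); rewrite (svalP (dC _ _ _)) acomp1f.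
have dC_comp S T U (ST : (S <= T)%O) (TU : (T <= U)%O) (SU : (S <= U)%O) :
    sval (dC T U TU) \oa sval (dC S T ST) = sval (dC S U SU).
  by apply: (cokernel_epi (cP S)); rewrite -acompA !(svalP (dC _ _ _)).
pose DK : diagram A I := Diagram dK_id dK_comp.
pose DC : diagram A I := Diagram dC_id dC_comp.
pose DF : diagram A I := @Diagram A _ I (fun=> F) (fun _ _ _ => aid F)
  (fun _ _ => erefl) (fun _ _ _ _ _ _ => acomp1f (aid F)).
have [C [c colC]] := colimit_ex abA cop DK.
have [S0 _] := directed_inhabited dirN.
have colF : @is_colimit A _ I DF F (fun=> aid F).
  split=> [S T ST|W w wP]; first exact: acomp1f.
  have wconst S : w S = w S0.
    have [T [ST S0T]] := directed_pair dirN S S0.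
    by rewrite -(wP _ _ ST) -(wP _ _ S0T).
  by exists (w S0); split=> [S|v <-]; rewrite acompf1.
(* The quotients die in the colimit: each [h] from [G] lies in a small set, the singleton [small1],
   so it is killed from some index on, and [G] generates. *)
have col0 : @is_colimit A _ I DC (azero A) (fun=> 0).
  split=> [S T ST|W w wP]; first by rewrite acomp0l.
  exists 0; split=> [S|v _]; last by rewrite [v]from_zero //; apply: azero_id.
  rewrite acomp0r; apply: (cokernel_epi (cP S)); rewrite acomp0l.
  apply/esym/(generator_eq genG) => h.
  have [T [ST hT]] := directed_pair dirN S (small1 (proj1 hL) h).
  rewrite -(wP _ _ ST) -(acompA _ _ (span_out _)) /= (svalP (dC S T ST)).
  rewrite -acompA; have [_ /(_ h) + _] := qP T => ->; first exact: acomp0r.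
  by move/small_set_le: hT; apply.
have [|fC [fCP _]] := (proj2 colC) F (fun S => span_in (q S)).
  by move=> S T ST; rewrite (svalP (dK S T ST)).
have exC : short_exact fC (0 : ahom F (azero A)).
  apply: (AB5 _ _ DK DF DC (fun S => span_in (q S)) (fun S => span_out (q S))
    _ _ _ c (fun=> aid F) (fun=> 0)) => //.
  - by move=> S T ST; rewrite /= (svalP (dK S T ST)) acomp1f.
  - by move=> S T ST; rewrite /= (svalP (dC S T ST)) acompf1.
  - by move=> S; rewrite fCP acomp1f.
  - by move=> S; rewrite !acomp0l.
  - by move=> S; have [] := qP S.
have [g gP] := kernel_lift (proj1 exC) (acomp0l (azero A) (aid F)).
have [S [u uP]] : exists S, exists u : ahom F (DK S), c S \oa u = g.
  (* Uniqueness in [hom_colimit] with values in [Prop]: the predicate of coming from a stage and the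
     constant [True] agree on all [c S \oa u], hence at [g]. *)
  have [h [_ hU]] := presF _ _ _ _ c dirL colC Prop (fun _ _ => True)
    (fun _ _ _ _ => erefl).
  rewrite -[exists S, _]/((fun x => exists S u, c S \oa u = x) g).
  rewrite -(hU (fun x => exists S u, c S \oa u = x)) ?(hU (fun=> True)) // => S u.
  by apply/propext; split=> // _; exists S, u.
(* The identity of [F] factors through the image attached to [S], so the quotient map is 0, and any
   [w] killing [S] factors through that map. *)
exists S => W w wS; have [_ _ /(_ W w wS)[v <-]] := qP S.
suff -> : span_out (q S) = 0 by rewrite acomp0r.
rewrite -[span_out _]acompf1 -gP -uP (acompA fC) fCP acompA (proj1 (kP S)).
exact: acomp0l.
Qed.

(** A small set injects into [L] by comparability of cardinals; elements of [L] outside the image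
    are sent to 0. *)
Lemma presentable_cover (G F : A) : is_generator G -> presentable L F ->
  exists phi : L -> ahom G F, forall W (w : ahom F W),
    (forall l, w \oa phi l = 0) -> w = 0.
Proof.
move=> genG presF; have [S SP] := presentable_cover_small genG presF.
have [|/card_le_injP[f f_inj]] := card_le_total [set: L] (val S).
  by move=> /small_setP.
pose E (l : L) (h : ahom G F) := (exists Sh : val S h,
  val (f (exist _ h (mem_set Sh))) = l) \/
  (h = 0 /\ forall h' (Sh' : val S h'), val (f (exist _ h' (mem_set Sh'))) <> l).
have /choice[phi phiP] : forall l, exists h, E l h.
  move=> l; have [[h [Sh hl]]|nl] := pselect (exists h (Sh : val S h),
      val (f (exist _ h (mem_set Sh))) = l); first by exists h; left; exists Sh.
  by exists 0; right; split=> // h Sh hl; apply: nl; exists h, Sh.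
exists phi => W w wphi; apply: SP => h Sh.
have [] := phiP (val (f (exist _ h (mem_set Sh)))); last first.
  by move=> [_ /(_ h Sh)].
by move=> [Sh' /val_inj/f_inj[e]]; rewrite -e wphi.
Qed.

End PresentableCover.

(** * Precovers by pure projective objects *)

Section Precover.
Variables (L : Type) (A : additive_category).
Hypotheses (hL : infinite_regular L) (hA : grothendieck A).

Lemma zero_pure_projective (Z : A) : is_zero Z -> pure_projective L Z.
Proof.
by move=> Z0 X Y W f g _ h; exists 0; rewrite acomp0r [h]from_zero.
Qed.

(* The index set is small because a presentable object is a quotient of the
   coproduct of L copies of the generator G, so that it is determined by the maps
   from G which the quotient map kills. *)
Lemma precover_ex (K : A) : exists P (p : ahom P K), pure_projective L P /\
  forall Q (u : ahom Q K), pure_projective L Q -> exists v, p \oa v = u.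
Proof.
have [abA cop _ [G genG]] := hA; have [ker_ex _ _ epi_coker] := abA.
have [GL [i iP]] := cop L (fun=> G).
have epi_from_GL F : presentable L F -> exists e : ahom GL F, epi e.
  move=> /(presentable_cover hL hA genG)[phi phiP].
  have [e eP] := coproduct_lift iP phi; exists e => W u v uv.
  apply/eqP; rewrite -subr_eq0; apply/eqP/phiP => l.
  by rewrite -eP acompA acompDl acompNl uv subrr acomp0l.
(* Index [inl v] asks for one pure projective through which [v] factors; index [inr (R, w)] for one
   presentable quotient of [GL] whose quotient map kills exactly the maps in [R], with a map to [K]
   inducing [w]. The zero object serves when nothing qualifies. *)
pose J := (ahom G K + set (ahom G GL) * ahom GL K)%type.
pose spec (j : J) (q : {Q : A & ahom Q K}) := match j with
  | inl v => forall Q (u : ahom Q K) g, pure_projective L Q ->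
      u \oa g = v -> exists g', projT2 q \oa g' = v
  | inr (R, w) => forall F (e : ahom GL F) (u : ahom F K), presentable L F ->
      epi e -> R = [set r | e \oa r = 0] -> u \oa e = w ->
      exists g, projT2 q \oa g = u
  end.
have /all_sig[q qP] : forall j,
    {q : {Q : A & ahom Q K} | pure_projective L (projT1 q) /\ spec j q}.
  pose q0 : {Q : A & ahom Q K} := existT _ (azero A) (0 : ahom (azero A) K).
  have PP0 : pure_projective L (projT1 q0).
    exact/zero_pure_projective/azero_id.
  case=> [v|[R w]]; apply: cid.
    have [[Q [u [g [PQ ugv]]]]|none] := pselect (exists Q (u : ahom Q K) g,
        pure_projective L Q /\ u \oa g = v).
      by exists (existT _ Q u); split=> // Q' u' g' _ _; exists g.
    exists q0; split=> // Q u g PQ ugv; case: none.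
    by exists Q, u, g.
  have [[F [e [u [presF epie Re uew]]]]|none] := pselect (exists F
      (e : ahom GL F) (u : ahom F K), [/\ presentable L F, epi e,
      R = [set r | e \oa r = 0] & u \oa e = w]).
    exists (existT _ F u); split.
      exact: presentable_pure_projective.
    move=> F' e' u' _ epie' Re' u'e'w /=.
    have [X [f fe']] := epi_coker _ _ e' epie'.
    have [Z [k kP]] := ker_ex _ _ e'.
    (* [e] and [e'] kill the same maps from [G], so [e] kills the kernel of [e'] and factors through
       [e']. *)
    have [|g gP] := cokernel_lift (is_cokernel_of_kernel fe' kP) (u := e).
      apply: (generator_eq genG) => h; rewrite -acompA.
      suff : R (k \oa h) by rewrite Re.
      by rewrite Re' /= acompA (proj1 kP) acomp0l.
    by exists g; apply: epie'; rewrite -acompA gP uew u'e'w.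
  exists q0; split=> // F e u presF epie Re uew; case: none.
  by exists F, e, u.
have [S [s sP]] := cop J (fun j => projT1 (q j)).
have [p pP] := coproduct_lift sP (fun j => projT2 (q j)).
have PS : pure_projective L S.
  by apply: (coproduct_pure_projective sP) => j; have [] := qP j.
exists S, p; split=> // Q u PQ.
(* Lifting is done over the image [T] of [p]. The [inr] summands make [p'] a pure epimorphism, along
   which [Q] lifts; the [inl] summands put every map from a pure projective to [K] inside [T], since
   its composites with maps from [G] factor through [p]. *)
have [T [p' [t [C [c [ptp' epip' cP tP]]]]]] := image_ex p abA.
have [Z [k kP]] := ker_ex _ _ p'.
have pure_p' : pure_exact L k p'.
  have [X [f fp']] := epi_coker _ _ p' epip'.
  split; first by split; last exact: is_cokernel_of_kernel fp' kP.
  move=> F presF; split=> [|v|w]; first exact: kernel_mono kP F.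
    split=> [/(kernel_lift kP)[z zP]|[z <-]]; first by exists z.
    by rewrite acompA (proj1 kP) acomp0l.
  have [e epie] := epi_from_GL F presF.
  have [_ /(_ F e (t \oa w) presF epie erefl erefl)[g gP]] :=
    qP (inr ([set r | e \oa r = 0], t \oa w \oa e)).
  exists (s (inr ([set r | e \oa r = 0], t \oa w \oa e)) \oa g).
  by apply: (kernel_mono tP); rewrite !acompA -ptp' pP.
have [|u' u'P] := kernel_lift tP (u := u).
  apply: (generator_eq genG) => g; rewrite -acompA.
  have [_ /(_ Q u g PQ erefl)[g' <-]] := qP (inl (u \oa g)).
  by rewrite -pP !acompA (proj1 cP) !acomp0l.
have [v vP] := PQ _ _ _ _ _ pure_p' u'.
by exists v; rewrite ptp' -acompA vP.
Qed.

End Precover.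

(** * Relative dimension *)

Section RelativeDimension.
Variables (L : Type) (A : additive_category).
Hypotheses (hL : infinite_regular L) (hA : grothendieck A).
Implicit Types K N P Q X Y Z : A.

Lemma retract_pure_projective X Y (i : ahom Y X) (r : ahom X Y) :
  r \oa i = aid Y -> pure_projective L X -> pure_projective L Y.
Proof.
move=> ri PX Z Z' Z'' f g fg h; have [h' h'P] := PX _ _ _ _ _ fg (h \oa r).
by exists (h' \oa i); rewrite acompA h'P -acompA ri acompf1.
Qed.

Lemma abip_pure_projective X Y :
  pure_projective L X -> pure_projective L Y -> pure_projective L (abip X Y).
Proof.
move=> PX PY Z Z' Z'' f g fg h.
have [u uP] := PX _ _ _ _ _ fg (h \oa ain1 X Y).
have [v vP] := PY _ _ _ _ _ fg (h \oa ain2 X Y).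
exists (u \oa apr1 X Y + v \oa apr2 X Y).
by rewrite acompDr !acompA uP vP -!acompA -acompDr abip_id acompf1.
Qed.

Definition precover Q N (p : ahom Q N) : Prop := pure_projective L Q /\
  forall P (u : ahom P N), pure_projective L P -> exists v, p \oa v = u.

Fixpoint pure_dim_le (k : nat) (N : A) : Prop :=
  if k is k'.+1 then exists K Q (i : ahom K Q) (p : ahom Q N),
    [/\ is_kernel i p, precover p & pure_dim_le k' K]
  else pure_projective L N.

Lemma precover_kernel_ex N : exists K Q (i : ahom K Q) (p : ahom Q N),
  is_kernel i p /\ precover p.
Proof.
have [Q [p pP]] := precover_ex hL hA N.
have [[ker_ex _ _ _] _ _ _] := hA; have [K [i iP]] := ker_ex _ _ p.
by exists K, Q, i, p.
Qed.

(* Schanuel's lemma for a retract N' of N (+) P. *)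
Lemma syzygy_retract N N' P (s : ahom N' (abip N P)) (r : ahom (abip N P) N')
    K Q (i : ahom K Q) (p : ahom Q N) K' Q' (i' : ahom K' Q') (p' : ahom Q' N') :
  r \oa s = aid N' -> pure_projective L P ->
  is_kernel i p -> precover p -> is_kernel i' p' -> precover p' ->
  exists (s' : ahom K' (abip K Q')) (r' : ahom (abip K Q') K'),
    r' \oa s' = aid K'.
Proof.
rewrite -abip_comp; move: (apr1 N P \oa s) (apr2 N P \oa s).
move: (r \oa ain1 N P) (r \oa ain2 N P) => r1 r2 s1 s2 rs PP ip [PQ pP] ip' [PQ' pP'].
have [a aP] := pP _ (s1 \oa p') PQ'; have [b bP] := pP' _ (r1 \oa p) PQ.
have [c cP] := pP' _ r2 PP.
(* Both [b \oa a + c \oa s2 \oa p'] and the identity of [Q'] lift [p'] along [p']; [h] is their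
   difference. Restricting to [K'] gives [v \oa u + h \oa i' = aid K']. *)
have [|h hP] := kernel_lift ip' (u := aid Q' - (b \oa a + c \oa s2 \oa p')).
  rewrite acompDr acompNr acompf1 acompDr !acompA bP cP -(acompA r1) aP acompA.
  by rewrite -acompDl rs acomp1f subrr.
have [|u uP] := kernel_lift ip (u := a \oa i').
  by rewrite acompA aP -acompA (proj1 ip') acomp0r.
have [|v vP] := kernel_lift ip' (u := b \oa i).
  by rewrite acompA bP -acompA (proj1 ip) acomp0r.
exists (ain1 K Q' \oa u + ain2 K Q' \oa i'), (v \oa apr1 K Q' + h \oa apr2 K Q').
rewrite abip_row_col; apply: (kernel_mono ip').
rewrite acompDr !acompA vP hP -acompA uP acompf1 !acompE -!acompA (proj1 ip').
by rewrite !acomp0r; zmod.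
Qed.

(** The spare summand [P] makes the induction go through: the kernel for a retract of [N] is only a
    retract of [K] (+) [Q']. *)
Lemma pure_dim_le_retract k N N' P (s : ahom N' (abip N P))
    (r : ahom (abip N P) N') : r \oa s = aid N' -> pure_projective L P ->
  pure_dim_le k N -> pure_dim_le k N'.
Proof.
elim: k N N' P s r => [|k IHk] N N' P s r rs PP /=.
  by move=> PN; apply: (retract_pure_projective rs); apply: abip_pure_projective.
move=> [K [Q [i [p [ip pP dimK]]]]].
have [K' [Q' [i' [p' [ip' pP']]]]] := precover_kernel_ex N'.
exists K', Q', i', p'; split=> //.
have [s' [r' r's']] := syzygy_retract rs PP ip pP ip' pP'.
exact: IHk r's' (proj1 pP') dimK.
Qed.

(** Since [N] is a retract of [N] (+) 0, the kernels of any two of its precovers are comparable, and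
    the given one can replace the one hidden in [pure_dim_le]. *)
Lemma pure_dim_le_syzygy k N K Q (i : ahom K Q) (p : ahom Q N) :
  is_kernel i p -> precover p -> pure_dim_le k.+1 N -> pure_dim_le k K.
Proof.
move=> ip pP [K' [Q' [i' [p' [ip' pP' dimK']]]]].
have P0 := @zero_pure_projective L _ _ (azero_id A).
have [s [r rs]] := syzygy_retract (apr1_in1 N (azero A)) P0 ip' pP' ip pP.
exact: pure_dim_le_retract rs (proj1 pP) dimK'.
Qed.

End RelativeDimension.

(** * Pure quasi-isomorphisms on elements *)

Section Pairs.
Variable A : additive_category.
Implicit Types X Y W : A.

Definition apair W X Y (a : ahom W X) (b : ahom W Y) : ahom W (abip X Y) :=
  ain1 X Y \oa a + ain2 X Y \oa b.

Lemma apr1_pair W X Y (a : ahom W X) (b : ahom W Y) :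
  apr1 X Y \oa apair a b = a.
Proof.
by rewrite acompDr !acompA apr1_in1 apr1_in2 acomp1f acomp0l addr0.
Qed.

Lemma apr2_pair W X Y (a : ahom W X) (b : ahom W Y) :
  apr2 X Y \oa apair a b = b.
Proof.
by rewrite acompDr !acompA apr2_in1 apr2_in2 acomp1f acomp0l add0r.
Qed.

Lemma abip_eq W X Y (u v : ahom W (abip X Y)) :
  apr1 X Y \oa u = apr1 X Y \oa v -> apr2 X Y \oa u = apr2 X Y \oa v -> u = v.
Proof.
move=> uv1 uv2; rewrite -[u]acomp1f -[v]acomp1f -abip_id.
by rewrite !acompDl -!acompA uv1 uv2.
Qed.

End Pairs.

Lemma int_succ_ind (P : int -> Prop) :
  (forall n, P (n + 1)) -> forall n, P n.
Proof. by move=> PS n; rewrite -(subrK 1 n). Qed.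

(** Cones and homotopies produce maps in degrees [n + 1]; this relabels them so that no cast is left
    in later equations. *)
Lemma int_succ_family (T : int -> Type) (t : forall n, T (n + 1)) :
  exists t' : forall n, T n, forall n, t' (n + 1) = t n.
Proof.
exists (fun n => ecast m (T m) (subrK 1 n) (t (n - 1))) => n.
move: (subrK 1 (n + 1)); rewrite (addrK 1 n) => e.
by rewrite (eq_irrelevance e erefl).
Qed.

(** The number of steps from [n] up to [b], and 0 from [b] on: the fuel of constructions that
    descend from degree [b]. *)
Definition int_depth (b n : int) : nat := if (b - n)%R is Posz k then k else 0%N.

Lemma int_depthP b n :
  b <= n /\ int_depth b n = 0%N \/
  n + int_depth b (n + 1) + 1 = b /\
    int_depth b n = (int_depth b (n + 1)).+1.
Proof.
rewrite /int_depth opprD addrA; have [bn|nb] := leP b n; [left|right].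
  by split=> //; move: bn; rewrite -subr_le0; case: (b - n) => [[|k]|k].
have e : b - n = (b - n - 1) + 1 by rewrite subrK.
have : 0 <= b - n - 1 by rewrite -addrA -opprD subr_ge0 lezD1.
case E : (b - n - 1) => [k|] // _; split.
  by rewrite -E -addrA subrK addrC subrK.
by rewrite e E /= addn1.
Qed.

Section QuasiIso.
Variables (L : Type) (A : additive_category).
Implicit Types X Y Z : cochain_complex A.

(* The induced map on the cohomology of Hom (P, -) is surjective and injective
   in degree n + 1. *)
Definition elementwise_qi X Y (f : chain_map X Y) : Prop :=
  forall P, pure_projective L P -> forall n,
  (forall y : ahom P (Y (n + 1)), cdiff Y (n + 1) \oa y = 0 ->
     exists x z, cdiff X (n + 1) \oa x = 0 /\
       y = f (n + 1) \oa x + cdiff Y n \oa z) /\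
  (forall (x : ahom P (X (n + 1))) z, cdiff X (n + 1) \oa x = 0 ->
     f (n + 1) \oa x = cdiff Y n \oa z -> exists w, x = cdiff X n \oa w).

Section Cone.
Variables (X Y : cochain_complex A) (f : chain_map X Y) (n : int) (W : A).
Implicit Types u : ahom W (abip (X (n + 1)) (Y n)).

Lemma apr1_coneE u : apr1 _ _ \oa (cdiff (cone f) n \oa u)
  = - (cdiff X (n + 1) \oa (apr1 _ _ \oa u)).
Proof. by rewrite !acompA apr1_cone_diff !acompNl. Qed.

Lemma apr2_coneE u : apr2 _ _ \oa (cdiff (cone f) n \oa u)
  = f (n + 1) \oa (apr1 _ _ \oa u) + cdiff Y n \oa (apr2 _ _ \oa u).
Proof. by rewrite !acompA apr2_cone_diff acompDl. Qed.

Lemma cone_cocycle u v : cdiff (cone f) n \oa u = v <->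
  - (cdiff X (n + 1) \oa (apr1 _ _ \oa u)) = apr1 _ _ \oa v /\
  f (n + 1) \oa (apr1 _ _ \oa u) + cdiff Y n \oa (apr2 _ _ \oa u)
    = apr2 _ _ \oa v.
Proof.
rewrite -apr1_coneE -apr2_coneE.
by split=> [<-|[v1 v2]]; last apply: abip_eq.
Qed.

End Cone.

(** This is the long exact sequence of the cone, read on maps out of [P], a cocycle of the cone
    being a pair. *)
Lemma pure_quasi_isoP X Y (f : chain_map X Y) :
  pure_quasi_iso L f <-> elementwise_qi f.
Proof.
split=> [qf P PP|qf P PP n u].
  have inj n (x : ahom P (X (n + 1))) z : cdiff X (n + 1) \oa x = 0 ->
      f (n + 1) \oa x = cdiff Y n \oa z -> exists w, x = cdiff X n \oa w.
    elim/int_succ_ind: n x z => n x z dx fx.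
    have [|w /cone_cocycle[w1 _]] := proj1 (qf P PP n (apair x (- z))).
      apply/cone_cocycle; rewrite !acomp0r !apr1_pair !apr2_pair.
      by rewrite dx oppr0 acompNr fx subrr.
    by exists (- (apr1 _ _ \oa w)); rewrite acompNr w1 apr1_pair.
  move=> n; split=> [y dy|]; last exact: inj.
  have [|w /cone_cocycle[]] := proj1 (qf P PP n (apair 0 y)).
    apply/cone_cocycle; rewrite !acomp0r !apr1_pair !apr2_pair.
    by rewrite !acomp0r dy oppr0 addr0.
  rewrite apr1_pair apr2_pair => w1 w2.
  exists (apr1 _ _ \oa w), (apr2 _ _ \oa w); rewrite w2; split=> //.
  by rewrite -[LHS]opprK w1 oppr0.
split=> [du|[w <-]]; last by rewrite acompA cdiff2 acomp0l.
have [] := proj1 (@cone_cocycle _ _ f (n + 1) _ u 0) du.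
move aE: (apr1 _ _ \oa u) => a; move bE: (apr2 _ _ \oa u) => b.
rewrite !acomp0r => da fab.
(* Injectivity makes [a] the coboundary of some [w]; then [b + f w] is a cocycle of [Y], to which
   surjectivity applies. *)
have [|w wP] := proj2 (qf P PP (n + 1)) a (- b) (oppr_inj (etrans da (esym (oppr0 _)))).
  by apply: (zmod_lin fab); rewrite acompNr; zmod.
have [|x [z [dx yE]]] := proj1 (qf P PP n) (b + f (n + 1) \oa w).
  rewrite -fab wP acompDr !acompA cmap_diff; zmod.
exists (apair (x - w) z); apply/cone_cocycle.
rewrite apr1_pair apr2_pair !acompDr !acompNr dx aE bE; split.
  by rewrite wP; zmod.
by zmod_from yE.
Qed.

End QuasiIso.

(** * Resolutions *)

Definition bounded_above (A : additive_category) (X : cochain_complex A) :=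
  exists b : int, forall n, b < n -> is_zero (X n).

Section Resolution.
Variables (L : Type) (A : additive_category).
Hypotheses (hL : infinite_regular L) (hA : grothendieck A).

Section Construction.
Variables (X : cochain_complex A) (b : int).
Hypothesis Xb : forall n, b < n -> is_zero (X n).

(* A term of the resolution in degree n, with its maps to X n and to the term
   built just before it, in degree n + 1. *)
Record res_term (n : int) := ResTerm {
  rt : A; rt_next : A; rt_aug : ahom rt (X n); rt_diff : ahom rt rt_next
}.

Definition res_cover (n : int) (s : res_term (n + 1)) P
    (q : ahom P (X n)) (d : ahom P (rt s)) : Prop :=
  [/\ pure_projective L P, rt_diff s \oa d = 0,
      rt_aug s \oa d = cdiff X n \oa q
    & forall Q (x : ahom Q (X n)) (y : ahom Q (rt s)), pure_projective L Q ->
        rt_diff s \oa y = 0 -> rt_aug s \oa y = cdiff X n \oa x ->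
        exists v, q \oa v = x /\ d \oa v = y].

(** The kernel of [f] consists of the pairs (x, y) that are, up to sign, the cocycles of the cone of
    the augmentation; a precover of it makes that cone acyclic on pure projectives. *)
Lemma res_cover_ex n (s : res_term (n + 1)) :
  {P : A & {qd : ahom P (X n) * ahom P (rt s) | res_cover qd.1 qd.2}}.
Proof.
suff /cid[P /cid qd] : exists P (qd : ahom P (X n) * ahom P (rt s)),
    res_cover qd.1 qd.2 by exists P.
pose f : ahom (abip (X n) (rt s)) (abip (rt_next s) (X (n + 1))) :=
  apair (rt_diff s \oa apr2 _ _)
    (rt_aug s \oa apr2 _ _ - cdiff X n \oa apr1 _ _).
have [[ker_ex _ _ _] _ _ _] := hA; have [K [k kP]] := ker_ex _ _ f.
have [P [p [PP pP]]] := precover_ex hL hA K.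
have fk : f \oa (k \oa p) = 0 by rewrite acompA (proj1 kP) acomp0l.
exists P, (apr1 _ _ \oa (k \oa p), apr2 _ _ \oa (k \oa p)); split=> //=.
- have := congr1 (acomp (apr1 _ _)) fk.
  by rewrite acomp0r acompA apr1_pair -acompA.
- have := congr1 (acomp (apr2 _ _)) fk.
  rewrite acomp0r acompA apr2_pair acompDl acompNl -!acompA.
  by move=> /eqP; rewrite subr_eq0 => /eqP.
- move=> Q x y PQ dy qy; have [|u uP] := kernel_lift kP (u := apair x y).
    apply: abip_eq; rewrite !acompA ?apr1_pair ?apr2_pair acomp0r.
      by rewrite -acompA apr2_pair dy.
    by rewrite acompDl acompNl -!acompA apr1_pair apr2_pair qy subrr.
  have [v vP] := pP _ u PQ; exists v; rewrite -!acompA vP uP.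
  by rewrite apr1_pair apr2_pair.
Qed.

Definition res_next n (s : res_term (n + 1)) : res_term n :=
  ResTerm (sval (projT2 (res_cover_ex s))).1 (sval (projT2 (res_cover_ex s))).2.

Lemma res_nextP n (s : res_term (n + 1)) :
  @res_cover n s (rt (res_next s)) (rt_aug (res_next s)) (rt_diff (res_next s)).
Proof. exact: svalP (projT2 (res_cover_ex s)). Qed.

(* The term of degree n of a resolution started with 0 in degree n + k. *)
Fixpoint res_iter (k : nat) (n : int) : res_term n :=
  if k is k'.+1 then res_next (res_iter k' (n + 1))
  else @ResTerm n (azero A) (azero A) 0 0.

Notation res_depth := (int_depth (b + 1)).

(** The depth of degree [n + 1] is one less than that of [n] only up to a provable equality, hence
    the test and the cast; the value 0 is right at depth 0, where the term is zero. *)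
Definition res_diff (k k' : nat) (n : int) :
    ahom (rt (res_iter k n)) (rt (res_iter k' (n + 1))) :=
  if k is k0.+1 then
    if @eqP _ k0 k' is ReflectT e then
      ecast j (ahom (rt (res_iter k0.+1 n)) (rt (res_iter j (n + 1)))) e
        (rt_diff (res_iter k0.+1 n))
    else 0
  else 0.

Lemma res_diffS k n : res_diff k.+1 k n = rt_diff (res_iter k.+1 n).
Proof.
by rewrite /res_diff; case: eqP => // e; rewrite (eq_irrelevance e erefl).
Qed.

Lemma res_diff0 k n : res_diff 0 k n = 0.
Proof. by []. Qed.

Lemma res_diff2 n : res_diff (res_depth (n + 1)) (res_depth (n + 1 + 1)) (n + 1)
  \oa res_diff (res_depth n) (res_depth (n + 1)) n = 0.
Proof.
have [[_ ->]|[_ ->]] := int_depthP (b + 1) n; first by rewrite res_diff0 acomp0r.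
have [[_ ->]|[_ ->]] := int_depthP (b + 1) (n + 1); first by rewrite res_diff0 acomp0l.
by rewrite !res_diffS; have [] := res_nextP (res_iter (res_depth (n + 1 + 1)).+1 (n + 1)).
Qed.

Definition resolution : cochain_complex A := CochainComplex res_diff2.

Lemma res_aug_comm n : rt_aug (res_iter (res_depth (n + 1)) (n + 1))
    \oa cdiff resolution n = cdiff X n \oa rt_aug (res_iter (res_depth n) n).
Proof.
rewrite /=; have [[_ ->]|[_ ->]] := int_depthP (b + 1) n.
  by rewrite res_diff0 !acomp0r.
by rewrite res_diffS; have [] := res_nextP (res_iter (res_depth (n + 1)) (n + 1)).
Qed.

Definition res_map : chain_map resolution X := ChainMap res_aug_comm.

Lemma resolution_pure_projective : pure_projective_terms L resolution.
Proof.
move=> n /=; case: (res_depth n) => [|k] /=.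
  exact/zero_pure_projective/azero_id.
by have [] := res_nextP (res_iter k (n + 1)).
Qed.

Lemma resolution_bounded n : b < n -> is_zero (resolution n).
Proof.
rewrite -lezD1 /= => bn; have [[_ ->]|[e _]] := int_depthP (b + 1) n.
  exact: azero_id.
by move: bn; rewrite -e -addrA gerDl leNgt ltr_wpDl.

Qed.

Lemma resolution_exact Q n (x : ahom Q (X n)) (y : ahom Q (resolution (n + 1))) :
  pure_projective L Q -> cdiff resolution (n + 1) \oa y = 0 ->
  res_map (n + 1) \oa y = cdiff X n \oa x ->
  exists v, res_map n \oa v = x /\ cdiff resolution n \oa v = y.
Proof.
move: y; rewrite /= => y PQ; have [[bn dn]|[_ dn]] := int_depthP (b + 1) n.
  have y0 : y = 0.
    by apply/to_zero/resolution_bounded; rewrite ltzD1 ltW // -lezD1.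
  exists 0; rewrite y0 !acomp0r; split=> //.
  by rewrite [x]to_zero //; apply: Xb; rewrite -lezD1.
move: y; rewrite dn => y; rewrite res_diffS.
have [[_ dn1]|[_ dn1]] := int_depthP (b + 1) (n + 1).
  move: y; rewrite dn1 => y.
  have [_ _ _ H] := res_nextP (res_iter 0 (n + 1)).
  by move=> _; apply: H => //; rewrite acomp0l.
move: y; rewrite dn1 => y; rewrite res_diffS.
have [_ _ _ H] := res_nextP (res_iter (res_depth (n + 1 + 1)).+1 (n + 1)).
exact: H.
Qed.

Lemma res_map_qi : elementwise_qi L res_map.
Proof.
move=> P PP n; split=> [y dy|x z dx].
  have [||v [vy dv]] := @resolution_exact P (n + 1) y 0 PP.
  - exact: acomp0r.
  - by rewrite acomp0r dy.
  by exists v, 0; rewrite vy acomp0r addr0.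
by move=> /(resolution_exact PP dx)[v [_ vx]]; exists v.
Qed.

End Construction.

Lemma resolution_ex (X : cochain_complex A) : bounded_above X ->
  exists Q (q : chain_map Q X),
    [/\ pure_projective_terms L Q, bounded_above Q & elementwise_qi L q].
Proof.
move=> [b Xb]; exists (resolution X b), (res_map X b); split.
- exact: resolution_pure_projective.
- by exists b; apply: resolution_bounded.
- exact: res_map_qi.
Qed.

End Resolution.

(** * Lifting through quasi-isomorphisms *)

Section Lifting.
Variables (L : Type) (A : additive_category).
Implicit Types X Y Q C : cochain_complex A.

Definition null_homotopic X Y (g : chain_map X Y) : Prop :=
  exists s : forall n, ahom (X (n + 1)) (Y n), forall n,
    g (n + 1) = cdiff Y n \oa s n + s (n + 1) \oa cdiff X (n + 1).

Section NullHomotopy.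
Variables (Q C : cochain_complex A) (g : chain_map Q C) (b : int).
Hypotheses (Qb : forall n, b < n -> is_zero (Q n))
  (PQ : pure_projective_terms L Q) (aC : pure_acyclic L C).

(** Chooses the next component of the homotopy whenever its equation is solvable; [null_iterS] shows
    that the default 0 is not reached in the cases of interest. *)
Definition null_step n (t : ahom (Q (n + 1 + 1)) (C (n + 1))) :
    ahom (Q (n + 1)) (C n) :=
  if pselect (exists s, g (n + 1) = cdiff C n \oa s + t \oa cdiff Q (n + 1))
    is left ex_s then sval (cid ex_s) else 0.

(* The homotopy in degree n, started with 0 in degree n + k. *)
Fixpoint null_iter (k : nat) (n : int) : ahom (Q (n + 1)) (C n) :=
  if k is k'.+1 then null_step (null_iter k' (n + 1)) else 0.

Lemma null_iterS k n :
  cdiff C (n + 1) \oa (null_iter k (n + 1) \oa cdiff Q (n + 1))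
    = cdiff C (n + 1) \oa g (n + 1) ->
  g (n + 1) = cdiff C n \oa null_iter k.+1 n
    + null_iter k (n + 1) \oa cdiff Q (n + 1).
Proof.
move=> dg; have : exists s, g (n + 1) = cdiff C n \oa s
    + null_iter k (n + 1) \oa cdiff Q (n + 1); last first.
  by rewrite [null_iter k.+1 n]/= /null_step; case: pselect => // e _; case: cid.
have [|s sP] := proj1 (aC (@PQ (n + 1)) (n := n)
    (g (n + 1) - null_iter k (n + 1) \oa cdiff Q (n + 1))).
  by rewrite acompDr acompNr dg subrr.
by exists s; rewrite sP subrK.
Qed.

(** Descending induction: it starts where [Q] vanishes one degree up, and the equation one degree up
    makes the next error a cocycle of the acyclic [C]. *)
Lemma null_iterP k n : b <= n + k%:Z + 1 ->
  g (n + 1) = cdiff C n \oa null_iter k.+1 n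
    + null_iter k (n + 1) \oa cdiff Q (n + 1).
Proof.
elim: k n => [|k IHk] n bnk; apply: null_iterS.
  rewrite -cmap_diff acomp0l acomp0r [cdiff Q _]to_zero ?acomp0r //.
  apply: Qb; move: bnk; rewrite addr0 => bnk.
  by apply: le_lt_trans bnk _; rewrite ltrDl.
rewrite -cmap_diff IHk; last first.
  by move: bnk; rewrite -addn1 PoszD [k%:Z + 1]addrC addrA.
by rewrite !acompE -[_ \oa cdiff Q _ \oa _]acompA cdiff2 acomp0r addr0.
Qed.

Lemma null_homotopic_acyclic : null_homotopic g.
Proof.
exists (fun n => null_iter (int_depth b n) n) => n.
have [[bn ->]|[bn ->]] := int_depthP b n; last first.
  by apply: null_iterP; rewrite bn.
have Q0 : is_zero (Q (n + 1)) by apply: Qb; rewrite ltzD1.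
by rewrite (from_zero (g _) Q0) (from_zero (cdiff Q _) Q0) !acomp0r addr0.
Qed.

End NullHomotopy.

Section Lift.
Variables (Q Q' Y : cochain_complex A) (w : chain_map Q' Y).
Hypotheses (Qb : bounded_above Q) (PQ : pure_projective_terms L Q)
  (wq : elementwise_qi L w).

(** The composite [Q -> Y -> cone w] is null-homotopic; the component of the null-homotopy in [Q']
    is the lift, and minus its component in [Y] is the homotopy. *)
Lemma qi_lift (g : chain_map Q Y) :
  exists f : chain_map Q Q', homotopic (chain_comp w f) g.
Proof.
have [b bQ] := Qb; have aw := proj2 (pure_quasi_isoP L w) wq.
have [s sP] := null_homotopic_acyclic (chain_comp (cone_in w) g) bQ PQ aw.
pose s1 n := apr1 _ _ \oa s n; pose s2 n := apr2 _ _ \oa s n.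
have E1 n : cdiff Q' (n + 1) \oa s1 n = s1 (n + 1) \oa cdiff Q (n + 1).
  have := congr1 (acomp (apr1 _ _)) (sP n).
  rewrite /= acompDr !acompA apr1_in2 acomp0l apr1_cone_diff => E.
  by apply: (zmod_lin E); rewrite !acompNl -!acompA; zmod.
have E2 n : g (n + 1) = w (n + 1) \oa s1 n + cdiff Y n \oa s2 n
    + s2 (n + 1) \oa cdiff Q (n + 1).
  have := congr1 (acomp (apr2 _ _)) (sP n).
  rewrite /= acompDr !acompA apr2_in2 acomp1f apr2_cone_diff => ->.
  by rewrite acompDl -!acompA.
have [f fE] := @int_succ_family (fun n => ahom (Q n) (Q' n)) s1.
have fP n : f (n + 1) \oa cdiff Q n = cdiff Q' n \oa f n.
  by elim/int_succ_ind: n => n; rewrite !fE E1.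
exists (ChainMap fP), (fun n => - s2 n) => n /=.
by rewrite E2 fE !acompE; zmod.
Qed.

(** A homotopy [s] between the composites makes (f - f', - s) a chain map from the shift of [Q] to
    [cone w]; a null-homotopy of it contains, up to sign, the homotopy sought. *)
Lemma qi_lift_unique (f f' : chain_map Q Q') :
  homotopic (chain_comp w f) (chain_comp w f') -> homotopic f f'.
Proof.
move=> [s sP]; have [b bQ] := Qb; have aw := proj2 (pure_quasi_isoP L w) wq.
pose h n := f n - f' n.
have hP n : h (n + 1) \oa cdiff Q n = cdiff Q' n \oa h n.
  by rewrite /h acompDl acompDr acompNl acompNr !cmap_diff.
have sP' n : w (n + 1) \oa h (n + 1)
    = cdiff Y n \oa s n + s (n + 1) \oa cdiff Q (n + 1).
  by rewrite -sP acompDr acompNr.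
pose u n : ahom (shiftc Q n) (cone w n) := apair (h (n + 1)) (- s n).
have uP n : u (n + 1) \oa cdiff (shiftc Q) n = cdiff (cone w) n \oa u n.
  apply/esym/cone_cocycle; rewrite apr1_pair apr2_pair sP'.
  rewrite !acompA apr1_pair apr2_pair /= /shiftc_diff !acompE !cmap_diff.
  by split; zmod.
have bQ' n : b < n -> is_zero (shiftc Q n).
  by move=> bn; apply: bQ; rewrite (lt_trans bn) // ltrDl.
have PQ' : pure_projective_terms L (shiftc Q) by move=> n; apply: PQ.
have [t tP] := null_homotopic_acyclic (ChainMap uP) bQ' PQ' aw.
have [r rE] := @int_succ_family (fun n => ahom (Q (n + 1)) (Q' n))
  (fun n => - (apr1 _ _ \oa t n)).
exists r; elim/int_succ_ind => n; rewrite !rE -[LHS]/(h (n + 1 + 1)).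
have := congr1 (acomp (apr1 _ _)) (tP n).
rewrite /= /u apr1_pair acompDr !acompA apr1_cone_diff /= /shiftc_diff => ->.
by rewrite !acompE; zmod.
Qed.

End Lift.

End Lifting.

(** * Pure quasi-isomorphisms: composition, homotopy invariance, cones *)

Section QuasiIsoTheory.
Variables (L : Type) (A : additive_category).
Implicit Types X Y Z Q C : cochain_complex A.

Lemma cmap_diffE X Y (f : chain_map X Y) n W (x : ahom W (X n)) :
  f (n + 1) \oa (cdiff X n \oa x) = cdiff Y n \oa (f n \oa x).
Proof. by rewrite !acompA cmap_diff. Qed.

Lemma cdiff2E X n W (x : ahom W (X n)) :
  cdiff X (n + 1) \oa (cdiff X n \oa x) = 0.
Proof. by rewrite acompA cdiff2 acomp0l. Qed.

Lemma elementwise_qi_comp X Y Z (g : chain_map Y Z) (f : chain_map X Y) :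
  elementwise_qi L g -> elementwise_qi L f -> elementwise_qi L (chain_comp g f).
Proof.
move=> qg qf P PP n; have [g_surj g_inj] := qg P PP n.
have [f_surj f_inj] := qf P PP n; split=> [z dz|x z dx]; rewrite /= -?acompA.
  have [y [z1 [dy ->]]] := g_surj z dz; have [x [y1 [dx ->]]] := f_surj y dy.
  exists x, (g n \oa y1 + z1); split=> //.
  by rewrite !acompDr cmap_diffE -acompA; zmod.
by move=> /g_inj[|w /(f_inj _ _ dx)//]; rewrite -cmap_diffE dx acomp0r.
Qed.

(** A cocycle [u] of [Y] differs from [f g u] by a coboundary, and [g u] is a coboundary in [X]. *)
Lemma pure_acyclic_homotopy X Y (f : chain_map X Y) (g : chain_map Y X) :
  homotopic (chain_comp f g) (chain_id Y) -> pure_acyclic L X ->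
  pure_acyclic L Y.
Proof.
move=> [s sP] aX P PP n u; split=> [du|[w <-]]; last exact: cdiff2E.
have [|w wP] := proj1 (aX P PP n (g (n + 1) \oa u)).
  by rewrite -cmap_diffE du acomp0r.
exists (f n \oa w - s n \oa u); have := congr1 (fun h => h \oa u) (sP n).
rewrite /= acompDl acompNl acomp1f acompDl -!acompA du acomp0r -wP cmap_diffE.
by move=> E; rewrite acompDr acompNr; zmod_from E.
Qed.

Lemma elementwise_qi_id X : elementwise_qi L (chain_id X).
Proof.
move=> P _ n; split=> [y dy|x z _]; last first.
  by rewrite acomp1f => ->; exists z.
by exists y, 0; rewrite acomp1f acomp0r addr0.
Qed.

(* The five lemma for the map of cones induced by a square commuting up to
   homotopy, carried out on elements. *)
Lemma cone_qi QX QY X Y (phi : chain_map QX QY) (f : chain_map X Y)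
    (p : chain_map QX X) (q : chain_map QY Y) :
  homotopic (chain_comp q phi) (chain_comp f p) ->
  elementwise_qi L p -> elementwise_qi L q ->
  exists m : chain_map (cone phi) (cone f), elementwise_qi L m.
Proof.
move=> [s sP] qip qiq.
have sE n W (x : ahom W (QX (n + 1))) : q (n + 1) \oa (phi (n + 1) \oa x)
    = f (n + 1) \oa (p (n + 1) \oa x) + cdiff Y n \oa (s n \oa x)
      + s (n + 1) \oa (cdiff QX (n + 1) \oa x).
  have := congr1 (fun h => h \oa x) (sP n).
  rewrite /= !acompDl acompNl -!acompA => E.
  by zmod_from E.
(* The square commutes only up to [s], which therefore enters as an off-diagonal entry. *)
pose m n : ahom (abip (QX (n + 1)) (QY n)) (abip (X (n + 1)) (Y n)) :=
  apair (p (n + 1) \oa apr1 _ _) (q n \oa apr2 _ _ + s n \oa apr1 _ _).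
have m1 n W (u : ahom W (abip (QX (n + 1)) (QY n))) :
    apr1 _ _ \oa (m n \oa u) = p (n + 1) \oa (apr1 _ _ \oa u).
  by rewrite (acompA (apr1 _ _)) /m apr1_pair -acompA.
have m2 n W (u : ahom W (abip (QX (n + 1)) (QY n))) : apr2 _ _ \oa (m n \oa u)
    = q n \oa (apr2 _ _ \oa u) + s n \oa (apr1 _ _ \oa u).
  by rewrite (acompA (apr2 _ _)) /m apr2_pair acompDl -!acompA.
have mP n : m (n + 1) \oa cdiff (cone phi) n = cdiff (cone f) n \oa m n.
  have := apr1_coneE phi (aid (abip (QX (n + 1)) (QY n))).
  have := apr2_coneE phi (aid (abip (QX (n + 1)) (QY n))).
  rewrite !acompf1 => D2 D1.
  apply/esym/cone_cocycle; rewrite m1 m2 D1 D2.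
  rewrite -[m n]acompf1 m1 m2 !acompf1 acompDr !acompNr.
  rewrite !acompDr !cmap_diffE sE; split=> //; zmod.
exists (@ChainMap A (cone phi) (cone f) m mP) => P PP n.
have [p_surj p_inj] := qip P PP n; have [p_surj1 p_inj1] := qip P PP (n + 1).
have [q_surj q_inj] := qiq P PP n; have [q_surj1 q_inj1] := qiq P PP (n + 1).
split.
  (* Surjectivity: the class of [x] lifts to [x']; injectivity of [q] makes [phi x'] the coboundary
     of some [z'], and the cocycle left over in [Y] lifts to [y']. *)
  move=> u /cone_cocycle[]; move xE: (apr1 _ _ \oa u) => x.
  move yE: (apr2 _ _ \oa u) => y; rewrite !acomp0r => dx fxy.
  have [|x' [x1 [dx' xx']]] := p_surj1 x; first by apply: oppr_inj; rewrite dx oppr0.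
  have [||z' z'E] := q_inj1 (phi (n + 1 + 1) \oa x')
      (s (n + 1) \oa x' - (y + f (n + 1) \oa x1)).
  - by rewrite -cmap_diffE dx' acomp0r.
  - rewrite sE dx' acomp0r !(acompDr, acompNr) -cmap_diffE.
    by apply: (zmod_lin fxy); rewrite xx' acompDr; zmod.
  have [|y' [y4 [dy' y3E]]] := q_surj (y + f (n + 1) \oa x1 + q (n + 1) \oa z'
      - s (n + 1) \oa x').
    rewrite !(acompDr, acompNr) -!cmap_diffE -z'E sE dx' acomp0r.
    by apply: (zmod_lin fxy); rewrite xx' acompDr; zmod.
  exists (apair x' (y' - z')), (apair (- x1) y4); split.
    apply/cone_cocycle; rewrite apr1_pair apr2_pair dx' !acomp0r.
    by rewrite acompDr acompNr dy' -z'E; split; zmod.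
  apply: abip_eq; rewrite acompDr.
    by rewrite m1 apr1_pair xE xx' apr1_coneE apr1_pair acompNr opprK.
  rewrite m2 apr1_pair apr2_pair yE apr2_coneE apr1_pair apr2_pair.
  by apply: (zmod_lin y3E); rewrite !(acompDr, acompNr); zmod.
(* Injectivity: [x'] is the coboundary of [x1], the cocycle [p x1 + x] lifts to [x2], and with
   [x1 - x2] in place of [x1] the obstruction left in [QY] is a coboundary. *)
move=> u v /cone_cocycle[]; move xE: (apr1 _ _ \oa u) => x'.
move yE: (apr2 _ _ \oa u) => y'; rewrite !acomp0r => dx' dy'.
move=> /esym/cone_cocycle[]; move vE1: (apr1 _ _ \oa v) => x.
move vE2: (apr2 _ _ \oa v) => y; rewrite m1 m2 xE yE => px' qy'.
have {}dx' : cdiff QX (n + 1 + 1) \oa x' = 0.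
  by apply: oppr_inj; rewrite dx' oppr0.
have [||x1 x1E] := p_inj1 x' (- x) => //; first by rewrite acompNr.
have [|x2 [x3 [dx2 x3E]]] := p_surj (p (n + 1) \oa x1 + x).
  rewrite acompDr -cmap_diffE -x1E.
  by zmod_from px'.
have [||y1 y1E] := q_inj (y' + phi (n + 1) \oa (x1 - x2))
    (y + f n \oa x3 + s n \oa (x1 - x2)).
- rewrite acompDr -cmap_diffE acompDr acompNr dx2 -x1E oppr0 addr0.
  by zmod_from dy'.
- rewrite acompDr sE !(acompDr, acompNr) dx2 -x1E -!cmap_diffE !acomp0r.
  have E := congr1 (acomp (f (n + 1))) x3E; rewrite !acompDr in E.
  by apply: (zmod_lin (zmod_add E (esym qy'))); zmod.
exists (apair (x2 - x1) y1); apply/esym/cone_cocycle.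
rewrite apr1_pair apr2_pair xE yE -y1E !(acompDr, acompNr) dx2 -x1E.
by split; zmod.
Qed.

End QuasiIsoTheory.

(** * Truncation and syzygies *)

Section Cocycles.
Variables (L : Type) (A : additive_category).
Hypotheses (hL : infinite_regular L) (hA : grothendieck A).
Implicit Types X Y Q : cochain_complex A.

Lemma cocycles_subproof Q n :
  {Z : A & {k : ahom Z (Q n) | is_kernel k (cdiff Q n)}}.
Proof.
have [[ker_ex _ _ _] _ _ _] := hA.
by have /cid[Z /cid kP] := ker_ex _ _ (cdiff Q n); exists Z.
Qed.

Definition cocycles Q n : A := projT1 (cocycles_subproof Q n).

Definition cocycles_in Q n : ahom (cocycles Q n) (Q n) :=
  sval (projT2 (cocycles_subproof Q n)).

Lemma cocycles_kernel Q n : is_kernel (cocycles_in Q n) (cdiff Q n).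
Proof. exact: svalP (projT2 (cocycles_subproof Q n)). Qed.

Section Truncation.
Variables (Q X : cochain_complex A) (q : chain_map Q X) (m : int).
Hypothesis Xm : forall n, n <= m -> is_zero (X n).

(* b0 and b1 stand for m <= n and m <= n + 1: the truncation is Q in degrees at
   least m, extended by the cocycles of degree m. *)
Definition trunc_obj (b0 b1 : bool) (n : int) : A :=
  if b0 then Q n else if b1 then cocycles Q (n + 1) else azero A.

Definition trunc_diff (b0 b1 b2 : bool) (n : int) :
    ahom (trunc_obj b0 b1 n) (trunc_obj b1 b2 (n + 1)) :=
  match b0, b1 return ahom (trunc_obj b0 b1 n) (trunc_obj b1 b2 (n + 1)) with
  | true, true => cdiff Q n
  | false, true => cocycles_in Q (n + 1)
  | _, _ => 0
  end.

Lemma trunc_diff2 b0 b1 b2 b3 n :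
  trunc_diff b1 b2 b3 (n + 1) \oa trunc_diff b0 b1 b2 n = 0.
Proof.
case: b0 b1 b2 => [] [] [] /=; rewrite ?acomp0l ?acomp0r //.
  exact: cdiff2.
by have [] := cocycles_kernel Q (n + 1).
Qed.

Definition truncation : cochain_complex A :=
  @CochainComplex A (fun n => trunc_obj (m <= n) (m <= n + 1) n)
    (fun n => trunc_diff (m <= n) (m <= n + 1) (m <= n + 1 + 1) n)
    (fun n => trunc_diff2 _ _ _ _ n).

Definition trunc_map (b0 b1 : bool) (n : int) : ahom (trunc_obj b0 b1 n) (X n) :=
  if b0 return ahom (trunc_obj b0 b1 n) (X n) then q n else 0.

Lemma trunc_mapP n :
  trunc_map (m <= n + 1) (m <= n + 1 + 1) (n + 1) \oa cdiff truncation n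
  = cdiff X n \oa trunc_map (m <= n) (m <= n + 1) n.
Proof.
rewrite /=; have [le_mn|lt_nm] := leP m n.
  have -> : m <= n + 1 by rewrite (le_trans le_mn) // lerDl.
  exact: cmap_diff.
have X0 : is_zero (X (n + 1)) by apply: Xm; rewrite lezD1.
by rewrite [LHS]to_zero // [RHS]to_zero.
Qed.

Definition truncation_map : chain_map truncation X :=
  @ChainMap A truncation X
    (fun n => trunc_map (m <= n) (m <= n + 1) n) trunc_mapP.

(** Above degree [m] nothing changes; in degree [m] every cocycle comes from the added term; in
    degree [m - 1] the differential is mono. The target vanishes up to degree [m]. *)
Lemma truncation_qi : elementwise_qi L q -> elementwise_qi L truncation_map.
Proof.
move=> qq P PP n; have [q_surj q_inj] := qq P PP n; split=> [y|x z].
  have [le_mn|lt_nm] := leP m n; last first.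
    move=> _; exists 0, 0; rewrite !acomp0r; split=> //.
    by rewrite [y]to_zero ?addr0 //; apply: Xm; rewrite lezD1.
  move=> /q_surj; rewrite /=.
  have -> : m <= n + 1 by rewrite (le_trans le_mn) // lerDl.
  by have -> : m <= n + 1 + 1 by rewrite (le_trans le_mn) // -addrA lerDl.
move: x; rewrite /=; have [le_mn|lt_nm] := leP m n.
  have -> : m <= n + 1 by rewrite (le_trans le_mn) // lerDl.
  have -> : m <= n + 1 + 1 by rewrite (le_trans le_mn) // -addrA lerDl.
  by move=> x dx; apply: q_inj dx.
have [le_mn1|lt_n1m] := leP m (n + 1).
  have -> : m <= n + 1 + 1 by rewrite (le_trans le_mn1) // lerDl.
  move=> x dx _; have [v vP] := kernel_lift (cocycles_kernel Q (n + 1)) dx.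
  by exists v.
have [_|_] := leP m (n + 1 + 1) => /= x dx _; exists 0; rewrite acomp0r.
  by apply: (kernel_mono (cocycles_kernel Q (n + 1 + 1))); rewrite dx acomp0r.
by rewrite [x]to_zero //; apply: azero_id.
Qed.

Lemma truncation_pure_projective : pure_projective_terms L Q ->
  pure_projective L (cocycles Q m) -> pure_projective_terms L truncation.
Proof.
move=> PQ PZ n; rewrite /=; have [le_mn|lt_nm] := leP m n; first exact: PQ.
have [le_mn1|_] := leP m (n + 1); last exact/zero_pure_projective/azero_id.
by rewrite /= (_ : n + 1 = m) //; apply/le_anti; rewrite le_mn1 lezD1 lt_nm.
Qed.

Lemma truncation_zero_below n : n + 1 < m -> is_zero (truncation n).
Proof.
move=> lt_n1m; have lt_nm : n < m by rewrite (lt_trans _ lt_n1m) // ltrDl.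
by rewrite /= !leNgt lt_n1m lt_nm; apply: azero_id.
Qed.

Lemma truncation_zero_above n : m <= n -> is_zero (Q n) -> is_zero (truncation n).
Proof. by move=> le_mn; rewrite /= le_mn. Qed.

End Truncation.

Section Syzygies.
Variables (Q X : cochain_complex A) (q : chain_map Q X).
Hypotheses (PQ : pure_projective_terms L Q) (qq : elementwise_qi L q).

(** Where [X] vanishes, every cocycle of [Q] on a pure projective is a coboundary, so that each
    object of cocycles is a syzygy of the next one. *)
Lemma cocycles_precover n : is_zero (X (n + 1)) ->
  exists p : ahom (Q n) (cocycles Q (n + 1)),
    is_kernel (cocycles_in Q n) p /\ precover L p.
Proof.
move=> X0; have k1 := cocycles_kernel Q (n + 1).
have k0 := cocycles_kernel Q n.
have [p pP] := kernel_lift k1 (cdiff2 Q n); exists p; split.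
  split=> [|W u pu].
    by apply: (kernel_mono k1); rewrite acompA pP (proj1 k0) acomp0r.
  by apply: (proj2 k0); rewrite -pP -acompA pu acomp0r.
split=> // P u PP.
have [||w wP] := proj2 (qq PP n) (cocycles_in Q (n + 1) \oa u) 0.
- by rewrite acompA (proj1 k1) acomp0l.
- by rewrite acomp0r [LHS]to_zero.
by exists w; apply: (kernel_mono k1); rewrite acompA pP wP.
Qed.

Variable a : int.
Hypothesis Xa : forall n, n <= a -> is_zero (X n).

Lemma pure_dim_le_cocycles_down k j : j <= a ->
  pure_dim_le L k (cocycles Q j) -> pure_projective L (cocycles Q (j - k%:Z)).
Proof.
elim: k j => [|k IHk] j le_ja; first by rewrite subr0.
rewrite -{1}(subrK 1 j) => dimZ.
have [|p [kp pP]] := @cocycles_precover (j - 1); first by rewrite subrK; apply: Xa.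
have -> : j - k.+1%:Z = j - 1 - k%:Z by rewrite -addrA -opprD -PoszD add1n.
apply: IHk (pure_dim_le_syzygy hL hA kp pP dimZ).
by rewrite (le_trans _ le_ja) // gerDl.
Qed.

Lemma pure_dim_le_cocycles_up k j : j + k%:Z <= a ->
  pure_projective L (cocycles Q j) -> pure_dim_le L k (cocycles Q (j + k%:Z)).
Proof.
elim: k => [|k IHk]; first by rewrite addr0.
have -> : k.+1%:Z = k%:Z + 1 by rewrite -addn1 PoszD.
rewrite addrA => le_a PZ.
have [|p [kp pP]] := @cocycles_precover (j + k%:Z); first exact: Xa.
exists (cocycles Q (j + k%:Z)), (Q (j + k%:Z)), (cocycles_in Q (j + k%:Z)), p.
by split=> //; apply: IHk => //; rewrite (le_trans _ le_a) // lerDl.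
Qed.

(* f = q (j + 1) is a precover of X (j + 1).  Its kernel is compared with the
   kernel N0 of the restriction of f to the cocycles, of which Q j is a precover:
   f factors through the cocycles up to the kernel of f, so that ker f is a
   retract of N0 (+) Q (j + 1). *)
Lemma pure_dim_le_top k j : is_zero (X j) -> cdiff X (j + 1) = 0 ->
  pure_dim_le L k (cocycles Q j) -> pure_dim_le L k.+2 (X (j + 1)).
Proof.
move=> X0 dX0 dimZ; pose f := q (j + 1); pose z := cocycles_in Q (j + 1).
have k0 := cocycles_kernel Q j; have k1 := cocycles_kernel Q (j + 1).
have dz : cdiff Q (j + 1) \oa z = 0 by case: k1.
have [[ker_ex _ _ _] _ _ _] := hA.
have surj P (u : ahom P (X (j + 1))) : pure_projective L P ->
    exists x, cdiff Q (j + 1) \oa x = 0 /\ f \oa x = u.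
  move=> PP; have [|x [y [dx ->]]] := proj1 (qq PP j) u.
    by rewrite dX0 acomp0l.
  by exists x; rewrite [y]to_zero // acomp0r addr0.
have [N0 [v kv]] := ker_ex _ _ (f \oa z).
have [M [l kl]] := ker_ex _ _ f.
have dimN0 : pure_dim_le L k.+1 N0.
  have [d' d'P] := kernel_lift k1 (cdiff2 Q j).
  have [|p pP] := kernel_lift kv (u := d').
    by rewrite -acompA d'P cmap_diff [q j]to_zero // acomp0r.
  have zvp : z \oa (v \oa p) = cdiff Q j by rewrite pP.
  exists (cocycles Q j), (Q j), (cocycles_in Q j), p; split=> //.
    split=> [|W u pu].
      apply: (kernel_mono kv); apply: (kernel_mono k1).
      by rewrite !acomp0r -/z 2!acompA -(acompA z) zvp (proj1 k0).
    by apply: (proj2 k0); rewrite -zvp -!acompA pu !acomp0r.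
  split=> // P u PP.
  have [||w wP] := proj2 (qq PP j) (z \oa (v \oa u)) 0.
  - by rewrite (acompA (cdiff _ _)) dz acomp0l.
  - by rewrite acomp0r !acompA -/f (proj1 kv) acomp0l.
  exists w; apply: (kernel_mono kv); apply: (kernel_mono k1).
  by rewrite -/z wP -zvp !acompA.
(* Lifting [f] to cocycles gives [f \oa z \oa t = f], so that [aid _ - z \oa t] lands in [M], the
   kernel of [f]; it is the second entry of [r]. *)
have [x [dx fx]] := surj _ f (@PQ (j + 1)).
have [t tP] := kernel_lift k1 dx.
have fzt : f \oa z \oa t = f by rewrite -acompA tP.
have [|s sP] := kernel_lift kv (u := t \oa l).
  by rewrite acompA fzt (proj1 kl).
have [|r rP] := kernel_lift kl (u := z \oa v \oa apr1 N0 (Q (j + 1))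
    + (aid _ - z \oa t) \oa apr2 N0 (Q (j + 1))).
  rewrite acompDr !acompA acompDr acompNr !acompA fzt (proj1 kv) acompf1.
  by rewrite subrr !acomp0l addr0.
exists M, (Q (j + 1)), l, f; split=> //.
  by split=> // P u PP; have [y [_ fy]] := surj P u PP; exists y.
apply: (@pure_dim_le_retract L A hL hA _ N0 M (Q (j + 1)) (apair s l) r) dimN0;
  last exact: (@PQ (j + 1)).
apply: (kernel_mono kl); rewrite acompA rP abip_row_col acompf1 -acompA sP.
by rewrite acompDl acomp1f acompNl -!acompA; zmod.
Qed.

End Syzygies.

(** From degree -(k + 1) to -1 there are [k] syzygy steps, and [pure_dim_le_top] adds two to reach
    degree 0. *)
Lemma stalk_pure_dim_le (M : A) Q (q : chain_map Q (stalk M)) k :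
  pure_projective_terms L Q -> elementwise_qi L q ->
  pure_projective L (cocycles Q (- (k%:Z + 1))) -> pure_dim_le L k.+2 M.
Proof.
move=> PQ qq PZ.
have Xa n : n <= -1 -> is_zero (stalk M n).
  move=> le_n; rewrite /= ifN; first exact: azero_id.
  by rewrite lt_eqF // (le_lt_trans le_n).
apply: (@pure_dim_le_top Q (stalk M) q PQ qq k (-1)) => //.
  exact: Xa.
have e : - (k%:Z + 1) + k%:Z = -1 by rewrite opprD addrAC addNr add0r.
have H := @pure_dim_le_cocycles_up Q (stalk M) q PQ qq (-1) Xa k (- (k%:Z + 1)).
by rewrite e in H; apply: H PZ; apply: lexx.
Qed.

End Cocycles.

(** * Localization and germs of complexes *)

Section LocalizationLift.
Variables (C D : category) (W : forall X Y : C, hom X Y -> Prop).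
Variables (F : functor C D)
  (FW : forall X Y (w : hom X Y), W w -> is_iso (fmap F w)).

Fixpoint loc_lift_map X Y (f : loc_hom W X Y) : hom (F X) (F Y) :=
  match f with
  | loc_mor _ _ f => fmap F f
  | loc_inv _ _ _ Ww => sval (cid (FW Ww))
  | loc_comp _ _ _ g f => loc_lift_map g \oc loc_lift_map f
  end.

Lemma loc_lift_id X : loc_lift_map (loc_mor W (idc X)) ~= idc (F X).
Proof. exact: fmap_id. Qed.

Lemma loc_lift_heq X Y (f g : loc_hom W X Y) :
  loc_heq f g -> loc_lift_map f ~= loc_lift_map g.
Proof.
elim=> {X Y f g} /=.
- by move=> X Y f; apply: heq_refl.
- by move=> X Y f g _; apply: heq_sym.
- by move=> X Y f g h _ fg _; apply: heq_trans.
- by move=> X Y Z g g' f f' _ gg' _; apply: heq_comp.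
- by move=> U X Y Z h g f; apply: compcA.
- move=> X Y f; apply: heq_trans (compc1f _).
  exact: heq_comp (fmap_id F Y) (heq_refl _).
- move=> X Y f; apply: heq_trans (compcf1 _).
  exact: heq_comp (heq_refl _) (fmap_id F X).
- by move=> X Y f g; apply: fmap_heq.
- by move=> X Y Z g f; apply: fmap_comp.
- move=> X Y w Ww; case: cid => v [vw wv] /=.
  exact: heq_trans vw (heq_sym (fmap_id F X)).
- move=> X Y w Ww; case: cid => v [vw wv] /=.
  exact: heq_trans wv (heq_sym (fmap_id F Y)).
Qed.

Definition loc_lift : functor (localization W) D :=
  @Functor (localization W) D F loc_lift_map loc_lift_heq loc_lift_id
    (fun X Y Z g f => heq_refl (loc_lift_map g \oc loc_lift_map f)).

End LocalizationLift.

Lemma is_iso_heq (C : category) (X Y : C) (f g : hom X Y) :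
  f ~= g -> is_iso f -> is_iso g.
Proof.
move=> fg [h [hf fh]]; exists h; split.
  exact: heq_trans (heq_comp (heq_refl h) (heq_sym fg)) hf.
exact: heq_trans (heq_comp (heq_sym fg) (heq_refl h)) fh.
Qed.

Lemma is_iso_square (C : category) (X Y X' Y' : C) (f : hom X Y)
    (f' : hom X' Y') (a : hom X X') (b : hom Y Y') :
  is_iso a -> is_iso b -> b \oc f ~= f' \oc a -> is_iso f' -> is_iso f.
Proof.
move=> ia [b' [b'b bb']] bf if'.
have ib' : is_iso b' by exists b.
apply: is_iso_heq (is_iso_comp ib' (is_iso_comp if' ia)).
apply: heq_trans (heq_comp (heq_refl b') (heq_sym bf)) _.
apply: heq_trans (compcA _ _ _) _.
by apply: heq_trans (heq_comp b'b (heq_refl f)) _; apply: compc1f.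
Qed.

Lemma triangle_iso_refl (C : category) (S : functor C C) (X Y Z : C)
    (f : hom X Y) (g : hom Y Z) (h : hom Z (S X)) :
  triangle_iso f g h f g h.
Proof.
have id_iso (U : C) : is_iso (idc U) by exists (idc U); split; apply: compc1f.
have comm (U V : C) (k : hom U V) : idc V \oc k ~= k \oc idc U.
  exact: heq_trans (compc1f k) (heq_sym (compcf1 k)).
exists (idc X), (idc Y), (idc Z); split=> //; split=> //.
exact: heq_trans (heq_comp (fmap_id S X) (heq_refl h)) (comm _ _ h).
Qed.

Definition eventually (P : int -> Prop) : Prop :=
  exists N : int, forall n, n < N -> P n.

Lemma eventually_and (P Q : int -> Prop) :
  eventually P -> eventually Q -> eventually (fun n => P n /\ Q n).
Proof.
move=> [N PN] [M QM]; exists (Num.min N M) => n; rewrite lt_min => /andP[nN nM].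
by split; [apply: PN | apply: QM].
Qed.

Lemma eventuallyS (P : int -> Prop) :
  eventually P -> eventually (fun n => P (n + 1)).
Proof. by move=> [N PN]; exists (N - 1) => n nN; apply: PN; rewrite -ltrBrDr. Qed.

Lemma eventually_pred (P : int -> Prop) :
  eventually (fun n => P (n + 1)) -> eventually P.
Proof.
move=> [N PN]; exists (N + 1) => n; rewrite -ltrBlDr => /PN.
by rewrite subrK.
Qed.

Lemma eventually_mono (P Q : int -> Prop) :
  (forall n, P n -> Q n) -> eventually P -> eventually Q.
Proof. by move=> PQ [N PN]; exists N => n /PN/PQ. Qed.

Lemma eventually_all (P : int -> Prop) : (forall n, P n) -> eventually P.
Proof. by exists 0. Qed.

(* The category of complexes and germs at - oo of chain maps, up to germs of
   homotopies; bounded complexes are zero in it. *)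
Section Germs.
Variable A : additive_category.
Implicit Types X Y Z : cochain_complex A.

Record germ X Y := Germ {
  germ_map :> forall n, ahom (X n) (Y n);
  germ_mapP : eventually (fun n =>
    germ_map (n + 1) \oa cdiff X n = cdiff Y n \oa germ_map n)
}.

Definition germ_heq X Y (f g : germ X Y) : Prop :=
  exists s : forall n, ahom (X (n + 1)) (Y n), eventually (fun n =>
    f (n + 1) - g (n + 1) = cdiff Y n \oa s n + s (n + 1) \oa cdiff X (n + 1)).

Lemma germ_heq_eq X Y (f g : germ X Y) :
  eventually (fun n => f (n + 1) = g (n + 1)) -> germ_heq f g.
Proof.
move=> fg; exists (fun n => 0); apply: eventually_mono fg => n ->.
by rewrite subrr acomp0l acomp0r addr0.
Qed.

Lemma germ_heq_refl X Y (f : germ X Y) : germ_heq f f.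
Proof. exact/germ_heq_eq/eventually_all. Qed.

Lemma germ_heq_sym X Y (f g : germ X Y) : germ_heq f g -> germ_heq g f.
Proof.
move=> [s sP]; exists (fun n => - s n); apply: eventually_mono sP => n sP.
by rewrite -opprB sP acompNl acompNr opprD.
Qed.

Lemma germ_heq_trans X Y (f g h : germ X Y) :
  germ_heq f g -> germ_heq g h -> germ_heq f h.
Proof.
move=> [s sP] [t tP]; exists (fun n => s n + t n).
apply: eventually_mono (eventually_and sP tP) => n [{}sP {}tP].
by rewrite -(subrKA (g (n + 1))) sP tP acompDl acompDr addrACA.
Qed.

Lemma germ_comp_subproof X Y Z (g : germ Y Z) (f : germ X Y) :
  eventually (fun n => g (n + 1) \oa f (n + 1) \oa cdiff X n
    = cdiff Z n \oa (g n \oa f n)).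
Proof.
apply: eventually_mono (eventually_and (germ_mapP g) (germ_mapP f)).
by move=> n [gP fP]; rewrite -acompA fP !acompA gP.
Qed.

Definition germ_comp X Y Z (g : germ Y Z) (f : germ X Y) : germ X Z :=
  Germ (germ_comp_subproof g f).

Definition germ_of X Y (f : chain_map X Y) : germ X Y :=
  Germ (eventually_all (cmap_diff f)).

Lemma germ_of_heq X Y (f g : chain_map X Y) :
  homotopic f g -> germ_heq (germ_of f) (germ_of g).
Proof. by move=> [s sP]; exists s; apply: eventually_all. Qed.

Lemma germ_comp_heq X Y Z (g g' : germ Y Z) (f f' : germ X Y) :
  germ_heq g g' -> germ_heq f f' -> germ_heq (germ_comp g f) (germ_comp g' f').
Proof.
move=> [s sP] [t tP].
exists (fun n => s n \oa f (n + 1) + g' n \oa t n).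
have fP := eventuallyS (germ_mapP f).
apply: eventually_mono (eventually_and (eventually_and sP tP)
  (eventually_and fP (germ_mapP g'))) => n [[{}sP {}tP] [{}fP g'P]] /=.
rewrite -(subrKA (g' (n + 1) \oa f (n + 1))).
rewrite -acompNl -acompDl -acompNr -acompDr sP tP.
rewrite !acompDl !acompDr !acompA -g'P -!acompA -fP.
by rewrite addrACA.
Qed.

Lemma germ_compA W X Y Z (h : germ Y Z) (g : germ X Y) (f : germ W X) :
  germ_heq (germ_comp h (germ_comp g f)) (germ_comp (germ_comp h g) f).
Proof. by apply/germ_heq_eq/eventually_all => n /=; rewrite acompA. Qed.

Lemma germ_comp1f X Y (f : germ X Y) :
  germ_heq (germ_comp (germ_of (chain_id Y)) f) f.
Proof. by apply/germ_heq_eq/eventually_all => n /=; rewrite acomp1f. Qed.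

Lemma germ_compf1 X Y (f : germ X Y) :
  germ_heq (germ_comp f (germ_of (chain_id X))) f.
Proof. by apply/germ_heq_eq/eventually_all => n /=; rewrite acompf1. Qed.

Definition germ_cat : category :=
  @Category (cochain_complex A) germ germ_heq (fun X => germ_of (chain_id X))
    germ_comp germ_heq_refl germ_heq_sym germ_heq_trans germ_comp_heq
    germ_compA germ_comp1f germ_compf1.

Lemma chain_zero_subproof X Y n :
  (0 : ahom (X (n + 1)) (Y (n + 1))) \oa cdiff X n
  = cdiff Y n \oa (0 : ahom (X n) (Y n)).
Proof. by rewrite acomp0l acomp0r. Qed.

Definition chain_zero X Y : chain_map X Y := ChainMap (@chain_zero_subproof X Y).

Definition germ_contractible X : Prop :=
  germ_heq (germ_of (chain_id X)) (germ_of (chain_zero X X)).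

Lemma bounded_germ_contractible X : bounded X -> germ_contractible X.
Proof.
move=> [a [b Xab]]; apply: germ_heq_eq; exists (a - 1) => n na.
by rewrite [LHS]to_zero //; apply: Xab; rewrite -ltrBrDr na.
Qed.

Lemma retract_germ_contractible X Y (f : germ X Y) (g : germ Y X) :
  germ_heq (germ_comp g f) (germ_of (chain_id X)) -> germ_contractible Y ->
  germ_contractible X.
Proof.
move=> gf Y0; apply: germ_heq_trans (germ_heq_sym gf) _.
have g0f : germ_heq (germ_comp g (germ_comp (germ_of (chain_zero Y Y)) f))
    (germ_of (chain_zero X X)).
  by apply: germ_heq_eq; apply: eventually_all => n /=; rewrite acomp0l acomp0r.
apply: germ_heq_trans g0f; apply: germ_comp_heq (germ_heq_refl g) _.
apply: germ_heq_trans (germ_heq_sym (germ_comp1f f)) _.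
exact: germ_comp_heq Y0 (germ_heq_refl f).
Qed.

Lemma cone_diff_in1 X Y (f : chain_map X Y) n : cdiff (cone f) n \oa ain1 _ _
  = ain2 _ _ \oa f (n + 1) - ain1 _ _ \oa cdiff X (n + 1).
Proof.
apply: abip_eq; rewrite acompA ?apr1_cone_diff ?apr2_cone_diff.
  rewrite -acompA apr1_in1 acompDr acompNr !acompA apr1_in1 apr1_in2 !acompE.
  by zmod.
rewrite acompDl acompDr acompNr -!acompA !(acompA (apr2 _ _)).
by rewrite apr1_in1 !apr2_in1 apr2_in2 !acompE subr0 addr0.
Qed.

Lemma cone_diff_in2 X Y (f : chain_map X Y) n :
  cdiff (cone f) n \oa ain2 _ _ = ain2 _ _ \oa cdiff Y n.
Proof. exact/esym/cone_in_subproof. Qed.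

(* The inverse is read off the corresponding component of the contraction. *)
Lemma cone_germ_contractible X Y (f : chain_map X Y) :
  germ_contractible (cone f) -> @is_iso germ_cat X Y (germ_of f).
Proof.
move=> [s sP].
pose s11 n : ahom (X (n + 1 + 1)) (X (n + 1)) :=
  apr1 _ _ \oa s n \oa ain1 _ _.
pose s12 n : ahom (Y (n + 1)) (X (n + 1)) := apr1 _ _ \oa s n \oa ain2 _ _.
pose s22 n : ahom (Y (n + 1)) (Y n) := apr2 _ _ \oa s n \oa ain2 _ _.
(* Three entries of the matrix identity id = d s + s d: [s12] is inverse to [f] on the left up to
   [s11], is a chain map, and is inverse on the right up to [s22]. *)
have E n : aid _ - 0 = cdiff (cone f) n \oa s n
      + s (n + 1) \oa cdiff (cone f) (n + 1) ->
  [/\ aid (X (n + 1 + 1)) = - (cdiff X (n + 1) \oa s11 n)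
        - s11 (n + 1) \oa cdiff X (n + 1 + 1)
        + s12 (n + 1) \oa f (n + 1 + 1),
      s12 (n + 1) \oa cdiff Y (n + 1) = cdiff X (n + 1) \oa s12 n
    & aid (Y (n + 1)) = f (n + 1) \oa s12 n + cdiff Y n \oa s22 n
        + s22 (n + 1) \oa cdiff Y (n + 1)].
  rewrite subr0 => id_n; split.
  - have := apr1_in1 (X (n + 1 + 1)) (Y (n + 1)).
    rewrite -[apr1 _ _ in LHS]acompf1 id_n.
    rewrite acompDr acompDl -!acompA cone_diff_in1 (acompA (apr1 _ _)).
    rewrite apr1_cone_diff /s11 /s12 !acompE => e.
    by zmod_from e.
  - have := apr1_in2 (X (n + 1 + 1)) (Y (n + 1)).
    rewrite -[apr1 _ _ in LHS]acompf1 id_n.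
    rewrite acompDr acompDl -!acompA cone_diff_in2 (acompA (apr1 _ _)).
    rewrite apr1_cone_diff /s12 !acompE => e.
    by zmod_from e.
  - have := apr2_in2 (X (n + 1 + 1)) (Y (n + 1)).
    rewrite -[apr2 _ _ in LHS]acompf1 id_n.
    rewrite acompDr acompDl -!acompA cone_diff_in2 (acompA (apr2 _ _)).
    rewrite apr2_cone_diff /s22 /s12 !acompE => e.
    by zmod_from e.
have {E}sE := eventually_mono E sP.
have [g gE] := @int_succ_family (fun n => ahom (Y n) (X n)) s12.
have [r rE] := @int_succ_family (fun n => ahom (X (n + 1)) (X n)) s11.
have gP : eventually (fun n => g (n + 1) \oa cdiff Y n = cdiff X n \oa g n).
  apply: eventually_pred; apply: eventually_mono sE => n [_ e _].
  by rewrite !gE.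
exists (Germ gP); split.
  exists r; apply: eventually_pred; apply: eventually_mono sE => n [e _ _] /=.
  by rewrite !gE !rE; zmod_from e.
exists (fun n => - s22 n); apply: eventually_mono sE => n [_ _ e] /=.
by rewrite gE acompNl acompNr; zmod_from e.
Qed.

End Germs.

(** * The resolution functor *)

Section ResolutionFunctor.
Variables (L : Type) (A : additive_category).
Hypotheses (hL : infinite_regular L) (hA : grothendieck A).

Lemma bounded_above_bounded (X : cochain_complex A) :
  bounded X -> bounded_above X.
Proof. by move=> [a [b Xab]]; exists b => n bn; apply: Xab; rewrite bn orbT. Qed.

Record is_resolution (X Q : cochain_complex A) (q : chain_map Q X) : Prop := {
  res_pp : pure_projective_terms L Q;
  res_bounded : bounded_above Q;
  res_qi : elementwise_qi L q
}.

Lemma resolution_subproof (X : bcomplex A) :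
  {Q : cochain_complex A & {q : chain_map Q X | is_resolution q}}.
Proof.
suff /cid[Q /cid[q qP]] : exists Q (q : chain_map Q X), is_resolution q.
  by exists Q, q.
have [Q [q [PQ Qb qq]]] := resolution_ex hL hA (bounded_above_bounded (bcxP X)).
by exists Q, q.
Qed.

Definition res_cx (X : bcomplex A) : cochain_complex A :=
  projT1 (resolution_subproof X).

Definition res_aug (X : bcomplex A) : chain_map (res_cx X) X :=
  sval (projT2 (resolution_subproof X)).

Lemma res_augP X : is_resolution (res_aug X).
Proof. exact: svalP (projT2 (resolution_subproof X)). Qed.

Section Comparison.
Variables (X Q Q' : cochain_complex A) (q : chain_map Q X) (q' : chain_map Q' X).
Hypotheses (qP : is_resolution q) (qP' : is_resolution q').

Lemma resolution_comparison : exists (f : chain_map Q Q') (g : chain_map Q' Q),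
  [/\ homotopic (chain_comp q' f) q, homotopic (chain_comp g f) (chain_id Q)
    & homotopic (chain_comp f g) (chain_id Q')].
Proof.
have [f fP] := qi_lift (res_bounded qP) (res_pp qP) (res_qi qP') q.
have [g gP] := qi_lift (res_bounded qP') (res_pp qP') (res_qi qP) q'.
exists f, g; split=> //.
  apply: (qi_lift_unique (res_bounded qP) (res_pp qP) (res_qi qP)).
  apply: (@homotopic_trans _ _ _ _ (chain_comp q' f)).
    apply: homotopic_trans (homotopic_comp gP (homotopic_refl f)).
    by apply: heq_of_eq => n /=; rewrite acompA.
  apply: homotopic_trans fP _.
  by apply: heq_of_eq => n /=; rewrite acompf1.
apply: (qi_lift_unique (res_bounded qP') (res_pp qP') (res_qi qP')).
apply: (@homotopic_trans _ _ _ _ (chain_comp q g)).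
  apply: homotopic_trans (homotopic_comp fP (homotopic_refl g)).
  by apply: heq_of_eq => n /=; rewrite acompA.
apply: homotopic_trans gP _.
by apply: heq_of_eq => n /=; rewrite acompf1.
Qed.

Lemma resolution_germ_contractible :
  germ_contractible Q -> germ_contractible Q'.
Proof.
have [f [g [_ _ fg]]] := resolution_comparison.
apply: (retract_germ_contractible (f := germ_of g) (g := germ_of f)).
apply: germ_heq_trans (germ_of_heq fg).
by apply: germ_heq_eq; apply: eventually_all.
Qed.

End Comparison.

Lemma res_fmap_subproof (X Y : bcomplex A) (f : chain_map X Y) :
  {g : chain_map (res_cx X) (res_cx Y) |
    homotopic (chain_comp (res_aug Y) g) (chain_comp f (res_aug X))}.
Proof.
apply: cid; have rX := res_augP X.
exact: qi_lift (res_bounded rX) (res_pp rX) (res_qi (res_augP Y)) _.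
Qed.

Definition res_fmap (X Y : bcomplex A) (f : chain_map X Y) :=
  sval (res_fmap_subproof f).

Lemma res_fmapP (X Y : bcomplex A) (f : chain_map X Y) :
  homotopic (chain_comp (res_aug Y) (res_fmap f)) (chain_comp f (res_aug X)).
Proof. exact: svalP (res_fmap_subproof f). Qed.

Lemma res_fmap_unique (X Y : bcomplex A) (f : chain_map X Y)
    (g : chain_map (res_cx X) (res_cx Y)) :
  homotopic (chain_comp (res_aug Y) g) (chain_comp f (res_aug X)) ->
  homotopic (res_fmap f) g.
Proof.
move=> gP; have rX := res_augP X; have rY := res_augP Y.
apply: (qi_lift_unique (res_bounded rX) (res_pp rX) (res_qi rY)).
exact: homotopic_trans (res_fmapP f) (homotopic_sym gP).
Qed.

Lemma res_fmap_heq (X Y : Kb_cat A) (f g : hom X Y) : f ~= g ->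
  germ_heq (germ_of (res_fmap f)) (germ_of (res_fmap g)).
Proof.
move=> fg; apply/germ_of_heq/res_fmap_unique.
apply: homotopic_trans (res_fmapP g) _.
exact: homotopic_comp (homotopic_sym fg) (homotopic_refl _).
Qed.

Lemma res_fmap_id (X : Kb_cat A) :
  germ_heq (germ_of (res_fmap (idc X))) (germ_of (chain_id (res_cx X))).
Proof.
apply/germ_of_heq/res_fmap_unique.
by apply: heq_of_eq => n /=; rewrite acompf1 acomp1f.
Qed.

Lemma res_fmap_comp (X Y Z : Kb_cat A) (g : hom Y Z) (f : hom X Y) :
  germ_heq (germ_of (res_fmap (g \oc f)))
    (germ_comp (germ_of (res_fmap g)) (germ_of (res_fmap f))).
Proof.
apply: (@germ_heq_trans _ _ _ _ (germ_of (chain_comp (res_fmap g) (res_fmap f)))).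
  apply/germ_of_heq/res_fmap_unique.
  apply: (@homotopic_trans _ _ _ _
      (chain_comp g (chain_comp (res_aug Y) (res_fmap f)))).
    apply: (@homotopic_trans _ _ _ _
        (chain_comp (chain_comp (res_aug Z) (res_fmap g)) (res_fmap f))).
      by apply: heq_of_eq => n /=; rewrite acompA.
    apply: homotopic_trans (homotopic_comp (res_fmapP g) (homotopic_refl _)) _.
    by apply: heq_of_eq => n /=; rewrite acompA.
  apply: homotopic_trans (homotopic_comp (homotopic_refl g) (res_fmapP f)) _.
  by apply: heq_of_eq => n /=; rewrite acompA.
by apply: germ_heq_eq; apply: eventually_all.
Qed.

Definition res_functor : functor (Kb_cat A) (germ_cat A) :=
  @Functor (Kb_cat A) (germ_cat A) res_cx
    (fun X Y f => germ_of (res_fmap f)) res_fmap_heq res_fmap_id res_fmap_comp.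

(** Composing [f] with the resolution of [X] gives another resolution of [Y], and [res_fmap f] is
    the comparison of the two. *)
Lemma res_functor_qi (X Y : bcomplex A) (f : chain_map X Y) :
  pure_acyclic L (cone f) -> is_iso (fmap res_functor (f : @hom (Kb_cat A) X Y)).
Proof.
move=> /(pure_quasi_isoP L f) qf; have rX := res_augP X; have rY := res_augP Y.
have rf : is_resolution (chain_comp f (res_aug X)).
  split; [exact: res_pp rX | exact: res_bounded rX |].
  exact: elementwise_qi_comp qf (res_qi rX).
have [u [v [uP vu uv]]] := resolution_comparison rf rY.
have fu := germ_of_heq (res_fmap_unique uP).
apply: (@is_iso_heq (germ_cat A) _ _ (germ_of u)); first exact: germ_heq_sym.
exists (germ_of v); split.
  apply: germ_heq_trans (germ_of_heq vu).
  by apply: germ_heq_eq; apply: eventually_all.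
apply: germ_heq_trans (germ_of_heq uv).
by apply: germ_heq_eq; apply: eventually_all.
Qed.

(** By [cone_qi] the cone of [res_fmap f] resolves the cone of [f], so its germ is contractible
    too. *)
Lemma res_functor_cone (X Y : bcomplex A) (f : chain_map X Y) :
  germ_contractible (res_cx (bcone f)) ->
  is_iso (fmap res_functor (f : @hom (Kb_cat A) X Y)).
Proof.
have rX := res_augP X; have rY := res_augP Y => contr.
apply: cone_germ_contractible.
have [m qm] := cone_qi (res_fmapP f) (res_qi rX) (res_qi rY).
apply: (resolution_germ_contractible (res_augP (bcone f)) _ contr).
split; [|have [[a aP] [b bP]] := (res_bounded rX, res_bounded rY)|exact: qm].
  move=> n; apply: abip_pure_projective; [exact: (res_pp rX)|exact: (res_pp rY)].
exists (Num.max a b) => n; rewrite gt_max => /andP[an bn].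
by apply: is_zero_abip; [apply: aP; rewrite ltr_wpDr|apply: bP].
Qed.

Lemma res_functor_pure_projective (X : bcomplex A) :
  pure_projective_terms L X -> germ_contractible (res_cx X).
Proof.
move=> PX; have Xb := bcxP X.
have rX : is_resolution (chain_id X).
  by split; [| exact: bounded_above_bounded | exact: elementwise_qi_id].
apply: (resolution_germ_contractible rX (res_augP X)).
exact: bounded_germ_contractible.
Qed.

Lemma iso_germ_contractible (X Y : germ_cat A) (f : hom X Y) :
  is_iso f -> germ_contractible X -> germ_contractible Y.
Proof. by move=> [g [_ fg]]; apply: retract_germ_contractible fg. Qed.

Lemma res_functor_Db (X Y : Kb A) (f : hom X Y) :
  cone_in_class (fun X : Kb A => pure_acyclic L X) f ->
  is_iso (fmap res_functor f).
Proof.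
move=> [Z [g [h [[X' [Y' [f' [a [b [c [[ia ib ic] [bf _ _]]]]]]]] aZ]]]].
apply: (is_iso_square (is_iso_fmap res_functor ia) (is_iso_fmap res_functor ib)
  (fmap_square res_functor bf)).
apply: res_functor_qi; have [c' [_ cc']] := ic.
exact: pure_acyclic_homotopy cc' aZ.
Qed.

Definition Db_functor : functor (Db L A) (germ_cat A) := loc_lift res_functor_Db.

(** A triangle of [Db] reaches a standard cone in two stages, by isomorphisms in [Db] and then in
    [Kb]; contractibility of germs passes through both. *)
Lemma res_functor_Dsg (X Y : Db L A) (f : hom X Y) :
  cone_in_class (fun X : Db L A => pure_projective_terms L X) f ->
  is_iso (fmap Db_functor f).
Proof.
move=> [Z [g [h [[X1 [Y1 [Z1 [f1 [g1 [h1 [dist]]]]]]]]]]].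
move=> [a [b [c [[ia ib ic] [bf _ _]]]]] PZ.
apply: (is_iso_square (is_iso_fmap Db_functor ia) (is_iso_fmap Db_functor ib)
  (fmap_square Db_functor bf)).
rewrite /= -/(fmap res_functor f1).
have [X2 [Y2 [f2 [a2 [b2 [c2 [[ia2 ib2 ic2] [bf2 _ _]]]]]]]] := dist.
apply: (is_iso_square (is_iso_fmap res_functor ia2)
  (is_iso_fmap res_functor ib2) (fmap_square res_functor bf2)).
apply: res_functor_cone.
apply: (iso_germ_contractible (is_iso_fmap res_functor ic2)).
apply: (iso_germ_contractible (is_iso_fmap Db_functor ic)).
exact: res_functor_pure_projective.
Qed.

Definition Dsg_functor : functor (Dsg L A) (germ_cat A) :=
  loc_lift res_functor_Dsg.

(** Endomorphisms of a zero object agree, so the identity and the chain map 0 have the same image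
    under [Dsg_functor]. *)
Lemma Dsg_zero_germ_contractible (X : bcomplex A) :
  @is_zero_object (Dsg L A) X -> germ_contractible (res_cx X).
Proof.
move=> /(_ X)[[u uP] _].
pose o : @hom (Kb_cat A) X X := chain_zero X X.
have e : @heq (Dsg L A) X X (idc (X : Dsg L A))
    (loc_mor _ (loc_mor _ o : @hom (Db L A) X X)).
  exact: heq_trans (uP _) (heq_sym (uP _)).
have := fmap_heq Dsg_functor e; rewrite /= => {}e.
apply: germ_heq_trans (germ_heq_sym (res_fmap_id X)) _.
apply: germ_heq_trans e _; apply/germ_of_heq/res_fmap_unique.
by apply: heq_of_eq => n /=; rewrite acomp0l acomp0r.
Qed.

End ResolutionFunctor.

(** * Zero objects *)

Section ZeroObjects.

(** By induction on words; for the formal inverse of [w : X -> Y], write [t X] as [t Y \oc w] and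
    cancel [w], and dually for [i]. *)
Lemma zero_object_localization (C : category)
    (W : forall X Y : C, hom X Y -> Prop) (Z : C) :
  is_zero_object Z -> @is_zero_object (localization W) Z.
Proof.
move=> Z0.
pose t X : hom X Z := sval (cid (proj2 (Z0 X))).
pose i X : hom Z X := sval (cid (proj1 (Z0 X))).
have tP X (v : hom X Z) : v ~= t X by apply: (svalP (cid (proj2 (Z0 X)))).
have iP X (v : hom Z X) : v ~= i X by apply: (svalP (cid (proj1 (Z0 X)))).
have tW X Y (f : loc_hom W X Y) :
    loc_heq (loc_comp (loc_mor W (t Y)) f) (loc_mor W (t X)).
  elim: f => {X Y} [X Y f|X Y w Ww|X Y V g gP f fP].
  - exact: loc_trans (loc_sym (loc_mor_comp _ _ _)) (loc_mor_heq _ (tP _ _)).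
  - have e := loc_mor_heq W (heq_sym (tP _ (t Y \oc w))).
    apply: loc_trans (loc_congr (loc_trans e (loc_mor_comp _ _ _)) (loc_refl _)) _.
    apply: loc_trans (loc_sym (loc_assoc _ _ _)) _.
    apply: loc_trans (loc_congr (loc_refl _) (loc_inv_r Ww)) _.
    exact: loc_id_r.
  - apply: loc_trans (loc_assoc _ _ _) _.
    exact: loc_trans (loc_congr gP (loc_refl _)) fP.
have iW X Y (f : loc_hom W X Y) :
    loc_heq (loc_comp f (loc_mor W (i X))) (loc_mor W (i Y)).
  elim: f => {X Y} [X Y f|X Y w Ww|X Y V g gP f fP].
  - exact: loc_trans (loc_sym (loc_mor_comp _ _ _)) (loc_mor_heq _ (iP _ _)).
  - have e := loc_mor_heq W (heq_sym (iP _ (w \oc i X))).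
    apply: loc_trans (loc_congr (loc_refl _) (loc_trans e (loc_mor_comp _ _ _))) _.
    apply: loc_trans (loc_assoc _ _ _) _.
    apply: loc_trans (loc_congr (loc_inv_l Ww) (loc_refl _)) _.
    exact: loc_id_l.
  - apply: loc_trans (loc_sym (loc_assoc _ _ _)) _.
    exact: loc_trans (loc_congr (loc_refl _) fP) gP.
have id_i : loc_heq (loc_mor W (idc Z)) (loc_mor W (i Z)).
  exact: loc_mor_heq (iP _ _).
have id_t : loc_heq (loc_mor W (idc Z)) (loc_mor W (t Z)).
  exact: loc_mor_heq (tP _ _).
move=> X; split.
  exists (loc_mor W (i X)) => v; apply: loc_trans (loc_sym (loc_id_r v)) _.
  exact: loc_trans (loc_congr (loc_refl v) id_i) (iW _ _ v).
exists (loc_mor W (t X)) => v; apply: loc_trans (loc_sym (loc_id_l v)) _.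
exact: loc_trans (loc_congr id_t (loc_refl v)) (tW _ _ v).
Qed.

Lemma zero_object_iso (C : category) (Z X : C) (f : hom Z X) :
  is_iso f -> is_zero_object Z -> is_zero_object X.
Proof.
move=> [g [_ fg]] Z0 Y; have [[i iP] [t tP]] := Z0 Y; split.
  exists (i \oc g) => v; apply: heq_trans (heq_sym (compcf1 v)) _.
  apply: heq_trans (heq_comp (heq_refl v) (heq_sym fg)) _.
  apply: heq_trans (compcA _ _ _) _; exact: heq_comp (iP _) (heq_refl g).
exists (f \oc t) => v; apply: heq_trans (heq_sym (compc1f v)) _.
apply: heq_trans (heq_comp (heq_sym fg) (heq_refl v)) _.
apply: heq_trans (heq_sym (compcA _ _ _)) _.
exact: heq_comp (heq_refl f) (tP _).
Qed.

Lemma loc_mor_iso (C : category) (W : forall X Y : C, hom X Y -> Prop) (X Y : C)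
    (w : hom X Y) : W X Y w -> @is_iso (localization W) X Y (loc_mor W w).
Proof. by move=> Ww; exists (loc_inv Ww); split; [apply: loc_inv_l|apply: loc_inv_r]. Qed.

End ZeroObjects.

(** * Vanishing in the singularity category and bounds on dimensions *)

Section Singularity.
Variables (L : Type) (A : additive_category).
Hypotheses (hL : infinite_regular L) (hA : grothendieck A).

Lemma zero_complex_subproof :
  (0 : ahom (azero A) (azero A)) \oa (0 : ahom (azero A) (azero A)) = 0.
Proof. exact: acomp0l. Qed.

Definition zero_complex : cochain_complex A :=
  @CochainComplex A (fun=> azero A) (fun=> 0) (fun=> zero_complex_subproof).

Lemma zero_complex_bounded : bounded zero_complex.
Proof. by exists 0, 0 => n _; apply: azero_id. Qed.

Definition zero_bcomplex : bcomplex A := BComplex zero_complex_bounded.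

Lemma Kb_zero_object : @is_zero_object (Kb_cat A) zero_bcomplex.
Proof.
move=> X; split.
  exists (chain_zero zero_complex X) => v; apply: heq_of_eq => n.
  by rewrite [LHS]from_zero //; apply: azero_id.
exists (chain_zero X zero_complex) => v; apply: heq_of_eq => n.
by rewrite [LHS]to_zero //; apply: azero_id.
Qed.

Lemma Dsg_zero_object : @is_zero_object (Dsg L A) zero_bcomplex.
Proof.
by apply: zero_object_localization; apply: zero_object_localization;
  apply: Kb_zero_object.
Qed.

Lemma Kb_cone_in_class (S : Kb A -> Prop) (X Y : bcomplex A) (f : chain_map X Y) :
  S (bcone f) -> @cone_in_class (Kb A) S X Y f.
Proof.
move=> Sf; exists (bcone f), (cone_in f), (cone_out f); split=> //.
by exists X, Y, f; apply: triangle_iso_refl.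
Qed.

(** The cone of 0 -> [T] has terms of the form 0 (+) T^n, so this map is inverted in the second
    quotient. *)
Lemma Dsg_zero_pure_projective (T : bcomplex A) :
  pure_projective_terms L T -> @is_zero_object (Dsg L A) T.
Proof.
move=> PT; pose f : chain_map zero_bcomplex T := chain_zero zero_complex T.
pose f' : @hom (Db L A) zero_bcomplex T := loc_mor _ (f : @hom (Kb A) _ _).
have cf : cone_in_class (fun X : Db L A => pure_projective_terms L X) f'.
  exists (bcone f), (loc_mor _ (cone_in f : @hom (Kb A) T (bcone f))).
  exists (loc_mor _ (cone_out f : @hom (Kb A) (bcone f) (bshift zero_bcomplex))).
  split; last first.
    move=> n; apply: abip_pure_projective; last exact: PT.
    exact/zero_pure_projective/azero_id.
  exists zero_bcomplex, T, (bcone f), f, (cone_in f), (cone_out f).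
  split; last exact: triangle_iso_refl.
  by exists zero_bcomplex, T, f; apply: triangle_iso_refl.
exact: zero_object_iso (loc_mor_iso cf) Dsg_zero_object.
Qed.

Lemma Dsg_zero_resolution (X T : bcomplex A) (t : chain_map T X) :
  pure_projective_terms L T -> elementwise_qi L t ->
  @is_zero_object (Dsg L A) X.
Proof.
move=> PT /(pure_quasi_isoP L t) qt.
have ct := @Kb_cone_in_class (fun X => pure_acyclic L X) T X t qt.
have it : @is_iso (Db L A) T X (loc_mor _ (t : @hom (Kb A) T X)).
  exact: loc_mor_iso ct.
have it' := is_iso_fmap (vfunctor (fun X : Db L A => pure_projective_terms L X)) it.
exact: zero_object_iso it' (Dsg_zero_pure_projective PT).
Qed.

Lemma stalk_zero (M : A) n : (n < 0) || (0 < n) -> is_zero (stalk M n).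
Proof.
move=> n0 /=; have -> : n == 0 = false; last exact: azero_id.
by case/orP: n0 => [/lt_eqF|/gt_eqF].
Qed.

Lemma stalk_bounded (M : A) : bounded (stalk M).
Proof. by exists 0, 0; apply: stalk_zero. Qed.

Lemma pure_dim_of_Dsg_zero (M : A) : zero_category (Dsg L A) ->
  exists k, pure_dim_le L k M.
Proof.
move=> /(_ (BComplex (stalk_bounded M))) Z0.
have [s [N sP]] := Dsg_zero_germ_contractible hL hA Z0.
have [PQ _ qq] := res_augP hL hA (BComplex (stalk_bounded M)).
(* The contraction is valid in degrees n + 1 with n < N; the degree j = -(|N| + 1) qualifies, as -
   |N| <= N, and [stalk_pure_dim_le] adds two. *)
exists (`|N|%N.+2); set Q := res_cx _ _ _ in PQ qq.
apply: (@stalk_pure_dim_le L A hL hA M Q (res_aug hL hA _) `|N|%N PQ qq).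
set j := - (`|N|%N%:Z + 1).
have jN : j - 1 < N.
  have leN : - `|N|%N%:Z <= N by rewrite abszE lerNnormlW.
  rewrite /j opprD -addrA; apply: le_lt_trans (lerD leN (lexx _)) _.
  by rewrite gtrDl.
have := sP _ jN; rewrite /= subr0 => e.
have kP := cocycles_kernel hA Q (j - 1 + 1).
have [d dP] := kernel_lift kP (cdiff2 Q (j - 1)).
rewrite -[j](subrK 1).
apply: (@retract_pure_projective L A (Q (j - 1)) _
  (s (j - 1) \oa cocycles_in hA Q (j - 1 + 1)) d); last exact: PQ.
apply: (kernel_mono kP); rewrite !acompA dP acompf1.
(* On cocycles the summand of the contraction that starts with the differential vanishes, so the
   other one splits the map onto them. *)
have := congr1 (fun h => h \oa cocycles_in hA Q (j - 1 + 1)) e.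
by rewrite acomp1f acompDl -[_ \oa cdiff Q _ \oa _]acompA (proj1 kP) acomp0r addr0.
Qed.

Lemma pure_dim_uniform : (forall M : A, exists k, pure_dim_le L k M) ->
  exists k, forall M : A, pure_dim_le L k M.
Proof.
move=> dimA; apply: contrapT => /forallNP none.
have /choice[M MP] : forall k, exists M : A, ~ pure_dim_le L k M.
  by move=> k; apply/existsNP; apply: none.
have [_ cop _ _] := hA; have [S [c cP]] := cop nat M.
(* A diagonal choice: the bound [k] of the coproduct passes to its retract [M k], chosen to violate
   it. *)
have [k dimS] := dimA S; apply: (MP k).
have [r rP] := coproduct_lift cP (dfwith (fun i => 0 : ahom (M i) (M k)) (aid (M k))).
have P0 := @zero_pure_projective L _ _ (azero_id A).
apply: (@pure_dim_le_retract L A hL hA k S (M k) _ (apair (c k) 0)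
  (r \oa apr1 S (azero A)) _ P0 dimS).
by rewrite -acompA apr1_pair rP dfwith_in.
Qed.

Lemma truncated_resolution (X : cochain_complex A) (a b : int) k :
  (forall n, (n < a) || (b < n) -> is_zero (X n)) ->
  (forall M : A, pure_dim_le L k M) ->
  exists T (t : chain_map T X), [/\ pure_projective_terms L T,
    elementwise_qi L t, bounded T
    & forall n, n + 1 + 1 + k%:Z < a -> is_zero (T n)].
Proof.
move=> Xab dimA.
have Xb : bounded_above X by exists b => n bn; apply: Xab; rewrite bn orbT.
have [Q [q [PQ [c Qc] qq]]] := resolution_ex hL hA Xb.
have Xa n : n <= a - 1 -> is_zero (X n).
  by rewrite lerBrDr lezD1 => na; apply: Xab; rewrite na.
(* [X] vanishes up to degree a - 1, where the cocycles have dimension at most [k]; they are pure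
   projective [k] degrees further down. *)
pose m := a - 1 - k%:Z.
have Xm n : n <= m -> is_zero (X n).
  by move=> nm; apply: Xa; rewrite (le_trans nm) // gerBl.
have PZ : pure_projective L (cocycles hA Q m).
  exact: (pure_dim_le_cocycles_down hL PQ qq Xa (lexx _) (dimA _)).
have T0 n : n + 1 + 1 + k%:Z < a -> is_zero (truncation hA Q m n).
  by move=> na; apply: truncation_zero_below; rewrite /m !ltrBrDr addrAC.
exists (truncation hA Q m), (truncation_map hA q Xm); split=> //.
- exact: truncation_pure_projective.
- exact: truncation_qi.
exists (a - k%:Z - 1 - 1), (Num.max c m) => n.
case/orP=> [na|]; first by apply: T0; rewrite -!ltrBrDr.
by rewrite gt_max => /andP[cn mn]; apply: truncation_zero_above (ltW mn) (Qc _ cn).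
Qed.

End Singularity.

Theorem proposition4p2 (L : Type) (A : additive_category)
  (hL : infinite_regular L) (hA : grothendieck A) :
  zero_category (Dsg L A) <-> finite_pure_gldim L A.
Proof.
split=> [Dsg0|[n dimA] X].
  have [k dimA] := pure_dim_uniform hL hA
    (fun M => pure_dim_of_Dsg_zero hL hA M Dsg0).
  (* With a = 0 the truncation vanishes in degrees i with i + 2 + k < 0. *)
  exists (k%:Z + 1 + 1) => M.
  have [T [t [PT qt _ T0]]] := truncated_resolution hL hA (@stalk_zero A M) dimA.
  exists T, t; split=> //; first exact/pure_quasi_isoP.
  move=> i ik; apply: T0; have -> : i + 1 + 1 + k%:Z = i + (k%:Z + 1 + 1) by zmod.
  by rewrite -ltrBrDr sub0r.
have {}dimA : exists k, forall M : A, pure_dim_le L k M.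
  (* [n] may be negative, hence the absolute value: degree -(|n| + 1) lies below -n, so the cocycles
     there are zero. *)
  exists `|n|%N.+2 => M; have [P [p [PP qp P0]]] := dimA M.
  apply: (@stalk_pure_dim_le L A hL hA M P p `|n|%N PP); first exact/pure_quasi_isoP/qp.
  apply: zero_pure_projective.
  apply: (kernel_mono (cocycles_kernel hA P _)).
  rewrite [LHS]to_zero ?acomp0r //; apply: P0.
  by rewrite ltrN2 ltzD1 abszE ler_norm.
have [k {}dimA] := dimA; have [a [b Xab]] := bcxP X.
have [T [t [PT qt Tb _]]] := truncated_resolution hL hA Xab dimA.
exact: (@Dsg_zero_resolution L A X (BComplex Tb) t).
Qed.
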